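(* Let $n\ge 1$ and let $\theta=(\theta_{jk})_{j,k=1,\dots,n}$ be a matrix with entries in the unit circle $\mathbb{T}$ such that $\theta_{kj}=\overline{\theta_{jk}}$ and $\theta_{jj}=1$ for all $j,k$. Let $|\cdot|$ be a norm on $\mathbb{Z}^n$ (the restriction of a norm on $\mathbb{R}^n$), let $a>0$ and $0<b<1$, and set $v(x)=e^{a|x|^b}$ for $x\in\mathbb{Z}^n$. Then $\ell^1_v(\mathbb{Z}^n,\theta)$ is inverse-closed in the non-commutative torus $C^*(\theta)$, and $\ell^1_v(\mathbb{Z}^n,\theta)$ is a Banach algebra that is a subalgebra of the smooth non-commutative torus $\mathcal{S}(\mathbb{Z}^n,\theta)$.
   Context: Define $\sigma:\mathbb{Z}^n\times\mathbb{Z}^n\to\mathbb{T}$ by $\sigma(l,m)=\prod_{1\le j<k\le n}\theta_{k,j}^{\,l_k m_j}$. For $f,g\in\ell^1(\mathbb{Z}^n)$ the twisted convolution is $(f\,\natural_\theta\, g)(x)=\sum_{y\in\mathbb{Z}^n} f(y)g(x-y)\sigma(y,x-y)$, and the involution is $f^*(x)=\overline{\sigma(x,-x)}\,\overline{f(-x)}$, $x\in\mathbb{Z}^n$. With these operations and the $\ell^1$-norm, $\ell^1(\mathbb{Z}^n)$ is a unital Banach $*$-algebra, denoted $\ell^1(\mathbb{Z}^n,\theta)$; its unit is $\delta_0$. For a weight $w:\mathbb{Z}^n\to(0,\infty)$ with $w(x+y)\le w(x)w(y)$ and $w(-x)=w(x)$ for all $x,y$, $\ell^1_w(\mathbb{Z}^n)$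 is the space of functions $f$ on $\mathbb{Z}^n$ with $\|f\|_{\ell^1_w}=\sum_{x\in\mathbb{Z}^n}|f(x)|w(x)<\infty$, and $\ell^1_w(\mathbb{Z}^n,\theta)$ denotes this space with the twisted convolution $\natural_\theta$. The smooth non-commutative torus is $\mathcal{S}(\mathbb{Z}^n,\theta)=\bigcap_{s\ge 0}\ell^1_{w_s}(\mathbb{Z}^n,\theta)$ with $w_s(x)=(1+|x|)^s$; equivalently it consists of all $f\in\ell^1(\mathbb{Z}^n)$ with $|f(x)|=\mathcal{O}(|x|^{-s})$ for all $s\ge 0$. The non-commutative torus $C^*(\theta)$ is the universal $C^*$-algebra generated by unitaries $U_1,\dots,U_n$ with $U_jU_k=\theta_{jk}U_kU_j$. It is the enveloping $C^*$-algebra of $\ell^1(\mathbb{Z}^n,\theta)$, and it is identified with the operator-norm closure of $\lambda(\ell^1(\mathbb{Z}^n))$ in the bounded operators on $\ell^2(\mathbb{Z}^n)$, where $\lambda(f)g=f\,\natural_\theta\, g$ for $f\in\ell^1(\mathbb{Z}^n)$, $g\in\ell^2(\mathbb{Z}^n)$ is the (faithful) regular representation. Subalgebras of $\ell^1(\mathbb{Z}^n,\theta)$ are regarded as subalgebras of $C^*(\theta)$ via $f\mapsto\lambda(f)$. Let $\mathcal{A}\subseteq\mathcal{B}$ be algebras with common identity. $\mathcal{A}$ is called inverse-closed in $\mathcal{B}$ if $a\in\mathcal{A}$ and $a^{-1}\in\mathcal{B}$ imply $a^{-1}\in\mathcal{A}$. *)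

(* Defs.v *)
From HB Require Import structures.
From mathcomp Require Import all_boot all_order all_algebra.
From mathcomp Require Import all_classical all_reals all_analysis.
From mathcomp Require Import complex ring lra.

Set Implicit Arguments.
Unset Strict Implicit.
Unset Printing Implicit Defensive.
Import Order.TTheory GRing.Theory Num.Theory.
Import numFieldNormedType.Exports.
Local Open Scope classical_set_scope.
Local Open Scope ring_scope.

(* The complex modulus, with values in R (`|z| has values in R[i]). *)
Notation cmod := ComplexField.Normc.normc.

Section Algebras.
Variables (R : realType) (E : lmodType R[i]).
Variables (mul : E -> E -> E) (one : E).

(* mul is only required to be well behaved on A: below it is a convolution
   of arbitrary functions, or the composition of arbitrary maps. *)
Record is_algebra (A : set E) : Prop := IsAlgebra {
  alg_one : A one;
  alg_lin : forall (c : R[i]) f g, A f -> A g -> A (c *: f + g);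
  alg_mul : forall f g, A f -> A g -> A (mul f g);
  alg_mulA : forall f g h, A f -> A g -> A h ->
    mul f (mul g h) = mul (mul f g) h;
  alg_mul1l : forall f, A f -> mul one f = f;
  alg_mul1r : forall f, A f -> mul f one = f;
  alg_linl : forall (c : R[i]) f g h, A f -> A g -> A h ->
    mul (c *: f + g) h = c *: mul f h + mul g h;
  alg_linr : forall (c : R[i]) f g h, A f -> A g -> A h ->
    mul h (c *: f + g) = c *: mul h f + mul h g }.

(* "Subalgebra" means subalgebra with common identity. *)
Definition is_subalgebra (A B : set E) : Prop :=
  [/\ is_algebra A, is_algebra B & A `<=` B].

Definition inverse_closed (A B : set E) : Prop :=
  is_subalgebra A B /\
  forall a b, A a -> B b -> mul a b = one -> mul b a = one -> A b.

(* nrm is only meaningful on A. *)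
Record is_banach_algebra (nrm : E -> R) (A : set E) : Prop := IsBanachAlgebra {
  ban_alg : is_algebra A;
  ban_norm_eq0 : forall f, A f -> nrm f = 0 -> f = 0;
  ban_normD : forall f g, A f -> A g -> nrm (f + g) <= nrm f + nrm g;
  ban_normZ : forall (c : R[i]) f, A f -> nrm (c *: f) = cmod c * nrm f;
  ban_normM : forall f g, A f -> A g -> nrm (mul f g) <= nrm f * nrm g;
  ban_norm1 : nrm one = 1;
  ban_complete : forall u : nat -> E, (forall k, A (u k)) ->
    (forall e : R, 0 < e -> exists N : nat, forall p q : nat,
       (N <= p)%N -> (N <= q)%N -> nrm (u p - u q) < e) ->
    exists2 l, A l & nrm (u k - l) @[k --> \oo] --> (0 : R) }.

End Algebras.

(* Sum of an absolutely summable family; esum itself is only meaningful for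
   nonnegative families. *)
Definition rsum (R : realType) (T : choiceType) (f : T -> R) : R :=
  fine (esum [set: T] (EFin \o f)^\+ - esum [set: T] (EFin \o f)^\-)%E.

Definition csum (R : realType) (T : choiceType) (f : T -> R[i]) : R[i] :=
  (rsum (fun x => complex.Re (f x)) +i* rsum (fun x => complex.Im (f x)))%C.

Definition is_norm (R : realType) (n : nat) (N : 'rV[R]_n -> R) : Prop :=
  [/\ forall x, N x = 0 -> x = 0,
      forall x y, N (x + y) <= N x + N y &
      forall (a : R) x, N (a *: x) = `|a| * N x].

Lemma cmod_ge0 (R : rcfType) (z : R[i]) : 0 <= cmod z.
Proof. by case: z => x y; exact: sqrtr_ge0. Qed.

Lemma esumZl_le (R : realType) (T : choiceType) (c : R) (f : T -> \bar R) :
  0 <= c -> (forall x, 0 <= f x)%E ->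
  (\esum_(x in [set: T]) (c%:E * f x) <= c%:E * \esum_(x in [set: T]) f x)%E.
Proof.
move=> c0 f0; apply: ge_ereal_sup => _ [X [finX XT] <-].
rewrite -ge0_mule_fsumr//; apply: lee_wpmul2l; first by rewrite lee_fin.
by apply: ereal_sup_ubound; exists X.
Qed.

Section TwistedConvolution.
Variables (R : realType) (n : nat).
Local Notation Zn := 'rV[int]_n.
Implicit Types (theta : 'M[R[i]]_n) (f g : Zn -> R[i]) (w : Zn -> R).

Definition sigma theta (l m : Zn) : R[i] :=
  \prod_(j < n) \prod_(k < n | (j < k)%N) theta k j ^ (l ord0 k * m ord0 j).

Definition twconv theta f g : Zn -> R[i] :=
  fun x => csum (fun y => f y * g (x - y) * sigma theta y (x - y)).

Definition delta0 : Zn -> R[i] := fun x => (x == 0)%:R.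

Definition ell1_enorm w f : \bar R :=
  (\esum_(x in [set: Zn]) (cmod (f x) * w x)%:E)%E.

Definition ell1_norm w f : R := fine (ell1_enorm w f).

Definition ell1 w : set (Zn -> R[i]) := [set f | (ell1_enorm w f < +oo)%E].

Definition latnorm (N : 'rV[R]_n -> R) (x : Zn) : R := N (map_mx intr x).

Definition subexp_weight (N : 'rV[R]_n -> R) (a b : R) (x : Zn) : R :=
  expR (a * latnorm N x `^ b).

Definition poly_weight (N : 'rV[R]_n -> R) (s : R) (x : Zn) : R :=
  (1 + latnorm N x) `^ s.

Definition smooth_torus (N : 'rV[R]_n -> R) : set (Zn -> R[i]) :=
  \bigcap_(s in [set s : R | 0 <= s]) ell1 (poly_weight N s).

End TwistedConvolution.

Section Ell2.
Variables (R : realType) (n : nat).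
Local Notation Zn := 'rV[int]_n.

Definition ell2_esqnorm (f : Zn -> R[i]) : \bar R :=
  (\esum_(x in [set: Zn]) (cmod (f x) ^+ 2)%:E)%E.

Definition ell2_pred : {pred Zn -> R[i]} :=
  fun f => (ell2_esqnorm f < +oo)%E.

Lemma ell2_submod_closed : submod_closed ell2_pred.
Proof.
split; first by rewrite unfold_in /ell2_esqnorm esum1// => x _;
  rewrite ComplexField.Normc.normc0 expr0n.
move=> c f g; rewrite !unfold_in /ell2_esqnorm => f2 g2.
set Sf := esum _ _ in f2; set Sg := esum _ _ in g2.
have c0 : 0 <= 2 * cmod c ^+ 2 by rewrite mulr_ge0// sqr_ge0.
have le : (\esum_(x in [set: Zn]) (cmod ((c *: f + g) x) ^+ 2)%:E <=
  (2 * cmod c ^+ 2)%:E * Sf + 2%:E * Sg)%E.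
  apply: (@le_trans _ _ (\esum_(x in [set: Zn])
    ((2 * cmod c ^+ 2)%:E * (cmod (f x) ^+ 2)%:E
     + 2%:E * (cmod (g x) ^+ 2)%:E))%E); last first.
    rewrite esumD; last 2 first.
    - by move=> x _; rewrite mule_ge0// lee_fin// sqr_ge0.
    - by move=> x _; rewrite mule_ge0// lee_fin// sqr_ge0.
    by apply: leeD; apply: esumZl_le => // x; rewrite lee_fin sqr_ge0.
  apply: le_esum => x _; rewrite -!EFinM -EFinD lee_fin.
  have := le_normcD (c * f x) (g x); rewrite ComplexField.Normc.normcM.
  rewrite -[c * f x + g x]/((c *: f + g) x) => h.
  have := cmod_ge0 ((c *: f + g) x).
  move: h; move: (cmod ((c *: f + g) x)) (cmod c) (cmod (f x)) (cmod (g x)).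
  move=> z p q r h z0; have := sqr_ge0 (p * q - r); nra.
apply: (le_lt_trans le); apply: lte_add_pinfty; apply: lte_mul_pinfty => //.
Qed.

HB.instance Definition _ :=
  GRing.isSubmodClosed.Build R[i] (Zn -> R[i]) ell2_pred ell2_submod_closed.

Record ell2 := Ell2 { ell2_fun :> Zn -> R[i]; _ : ell2_fun \in ell2_pred }.

HB.instance Definition _ := [isSub for ell2_fun].
HB.instance Definition _ := [Choice of ell2 by <:].
HB.instance Definition _ := [SubChoice_isSubLmodule of ell2 by <:].

Definition ell2_norm (g : ell2) : R := Num.sqrt (fine (ell2_esqnorm g)).

(* B(l^2) as a set of functions, with pointwise vector space structure and
   composition as product. *)
Definition bounded_op (T : ell2 -> ell2) : Prop :=
  linear T /\ exists M : R, forall g, ell2_norm (T g) <= M * ell2_norm g.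

Definition opnorm (T : ell2 -> ell2) : R :=
  sup [set ell2_norm (T g) | g in [set g | ell2_norm g <= 1]].

(* The default value 0 is never used when f is in l^1, see lambdaE below. *)
Definition lambda (theta : 'M[R[i]]_n) (f : Zn -> R[i]) (g : ell2) : ell2 :=
  insubd 0 (twconv theta f g).

Lemma rsum_le (f : Zn -> R) :
  (`|rsum f|%:E <= \esum_(x in [set: Zn]) `|f x|%:E)%E.
Proof.
have [|h] := leP (+oo)%E (\esum_(x in [set: Zn]) `|f x|%:E)%E.
  by rewrite leye_eq => /eqP ->; rewrite leey.
have e0 : (0 <= esum [set: Zn] (EFin \o f)^\+)%E by apply: esum_ge0.
have e1 : (0 <= esum [set: Zn] (EFin \o f)^\-)%E by apply: esum_ge0.
have E : (\esum_(x in [set: Zn]) `|f x|%:E = esum [set: Zn] (EFin \o f)^\+ +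
    esum [set: Zn] (EFin \o f)^\-)%E.
  rewrite -esumD//; apply: eq_esum => x _.
  by rewrite -[RHS]/(((EFin \o f)^\+ \+ (EFin \o f)^\-)%E x) -fune_abse.
move: h; rewrite E /rsum.
move: e0 e1; case: (esum _ (EFin \o f)^\+)%E => [p||]//;
  last by move=> _; case: (esum _ (EFin \o f)^\-)%E.
case: (esum _ (EFin \o f)^\-)%E => // q /=.
by rewrite !lee_fin => p0 q0 _; rewrite ler_norml; apply/andP; split; lra.
Qed.

Lemma csum_le (f : Zn -> R[i]) :
  ((cmod (csum f))%:E <= 2%:E * \esum_(x in [set: Zn]) (cmod (f x))%:E)%E.
Proof.
apply: (@le_trans _ _ (`|rsum (fun x => complex.Re (f x))|%:E
   + `|rsum (fun x => complex.Im (f x))|%:E)%E).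
  rewrite -EFinD lee_fin /csum /=; set p := rsum _; set q := rsum _.
  rewrite -[leRHS]ger0_norm ?addr_ge0// -sqrtr_sqr ler_wsqrtr// sqrrD.
  by rewrite !real_normK ?num_real// lerD2r lerDl mulrn_wge0// mulr_ge0.
have le2 (g : R[i] -> R) : (forall z, `|g z| <= cmod z) ->
    (`|rsum (fun x => g (f x))|%:E <=
     \esum_(x in [set: Zn]) (cmod (f x))%:E)%E.
  move=> gc; apply: (le_trans (rsum_le _)); apply: le_esum => x _.
  by rewrite lee_fin.
rewrite (_ : 2%:E = 1 + 1)%E//.
rewrite ge0_muleDl// mul1e; apply: leeD; apply: le2 => -[p q] /=;
  by rewrite -sqrtr_sqr ler_wsqrtr// ?lerDl ?lerDr sqr_ge0.
Qed.

Lemma cmod_sigma (theta : 'M[R[i]]_n) (l m : Zn) :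
  (forall j k, cmod (theta j k) = 1) -> cmod (sigma theta l m) = 1.
Proof.
move=> th1; rewrite /sigma.
have cmod1 : cmod (1 : R[i]) = 1 by exact: ComplexField.Normc.normc1.
elim/big_ind: _ => // [z w hz hw|j _].
  by rewrite ComplexField.Normc.normcM hz hw mulr1.
elim/big_ind: _ => // [z w hz hw|k _].
  by rewrite ComplexField.Normc.normcM hz hw mulr1.
have hX p : cmod (theta k j ^+ p) = 1.
  elim: p => [|p ih]; first by rewrite expr0.
  by rewrite exprS ComplexField.Normc.normcM ih th1 mulr1.
case: (l ord0 k * m ord0 j) => p; first exact: hX.
by rewrite NegzE -exprnN ComplexField.Normc.normcV hX invr1.
Qed.

(* Schur's test, up to the constant 4 coming from csum_le. *)
Lemma twconv_ell2 (theta : 'M[R[i]]_n) (f g : Zn -> R[i]) :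
  (forall j k, cmod (theta j k) = 1) ->
  ell1 (fun=> 1) f -> g \in ell2_pred -> twconv theta f g \in ell2_pred.
Proof.
move=> th1 f1; rewrite !unfold_in => g2.
pose S1 := (\esum_(y in [set: Zn]) (cmod (f y))%:E)%E.
have S1fin : (S1 < +oo)%E.
  by move: f1; rewrite /ell1/= /ell1_enorm; under eq_esum do rewrite mulr1.
have S10 : (0 <= S1)%E by apply: esum_ge0 => y _; rewrite lee_fin cmod_ge0.
pose S2 x := (\esum_(y in [set: Zn]) (cmod (f y) * cmod (g (x - y)) ^+ 2)%:E)%E.
have S20 x : (0 <= S2 x)%E.
  by apply: esum_ge0 => y _; rewrite lee_fin mulr_ge0 ?cmod_ge0// sqr_ge0.
have [M M0 S1M] : exists2 M : R, 0 < M & (S1 <= M%:E)%E.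
  exists (fine S1 + 1); first by rewrite ltr_wpDl// fine_ge0.
  rewrite EFinD fineK; first by rewrite leeDl.
  by rewrite ge0_fin_numE.
have pt x : ((cmod (twconv theta f g x) ^+ 2)%:E <= (4 * M)%:E * S2 x)%E.
  have [|S2fin] := leP (+oo)%E (S2 x).
    by rewrite leye_eq => /eqP ->; rewrite gt0_muley ?leey// lte_fin mulr_gt0.
  pose r := fine (S2 x); have rE : S2 x = r%:E by rewrite fineK// ge0_fin_numE.
  set u := cmod _; have u0 : 0 <= u by exact: cmod_ge0.
  have ut (t : R) : 0 < t -> u <= t * M + t^-1 * r.
    move=> t0; rewrite -lee_fin; apply: (le_trans (csum_le _)).
    apply: (@le_trans _ _ (\esum_(y in [set: Zn]) (t%:E * (cmod (f y))%:E +
        t^-1%:E * (cmod (f y) * cmod (g (x - y)) ^+ 2)%:E))%E).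
      apply: (@le_trans _ _ (2%:E * \esum_(y in [set: Zn])
          (2^-1%:E * (t%:E * (cmod (f y))%:E +
        t^-1%:E * (cmod (f y) * cmod (g (x - y)) ^+ 2)%:E)))%E).
        rewrite lee_wpmul2l ?lee_fin//; apply: le_esum => y _.
        rewrite -!EFinM lee_fin.
        rewrite !ComplexField.Normc.normcM cmod_sigma// mulr1.
        have := cmod_ge0 (f y).
        move: (cmod (f y)) (cmod (g _)) => p q p0.
        have h : 2 * q <= t + t^-1 * q ^+ 2.
          rewrite -subr_ge0 (_ : _ - _ = t * (1 - t^-1 * q) ^+ 2).
            by rewrite mulr_ge0 ?sqr_ge0// ltW.
          by field; rewrite gt_eqF.
        rewrite (_ : _ * (_ + _) = 2^-1 * (p * (t + t^-1 * q ^+ 2))); last by ring.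
        by rewrite ler_pdivlMl// mulrCA ler_wpM2l.
      apply: (@le_trans _ _ (2%:E * (2^-1%:E * \esum_(y in [set: Zn])
          (t%:E * (cmod (f y))%:E +
        t^-1%:E * (cmod (f y) * cmod (g (x - y)) ^+ 2)%:E)))%E).
        rewrite lee_wpmul2l ?lee_fin//; apply: esumZl_le => // y.
        rewrite adde_ge0// -EFinM lee_fin mulr_ge0 ?invr_ge0 ?cmod_ge0 ?(ltW t0)//.
        by rewrite mulr_ge0 ?cmod_ge0// sqr_ge0.
      by rewrite muleA -EFinM divff// mul1e.
    rewrite esumD; last 2 first.
    - by move=> y _; rewrite -EFinM lee_fin mulr_ge0 ?cmod_ge0// ltW.
    - move=> y _; rewrite -EFinM lee_fin mulr_ge0 ?invr_ge0 ?(ltW t0)//.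
      by rewrite mulr_ge0 ?cmod_ge0// sqr_ge0.
    rewrite EFinD; apply: leeD.
      apply: (le_trans (esumZl_le (ltW t0) _)).
        by move=> y; rewrite lee_fin cmod_ge0.
      by rewrite EFinM lee_wpmul2l ?lee_fin// ltW.
    have ti0 : 0 <= t^-1 by rewrite invr_ge0 ltW.
    apply: (le_trans (esumZl_le ti0 _)).
      by move=> y; rewrite lee_fin mulr_ge0 ?cmod_ge0// sqr_ge0.
    by rewrite EFinM -rE.
  rewrite rE -EFinM lee_fin.
  have r0 : 0 <= r by rewrite -lee_fin -rE.
  have [u_eq0|u_neq0] := eqVneq u 0.
    by rewrite u_eq0 expr0n/= mulr_ge0// mulr_ge0// ltW.
  have up : 0 < u by rewrite lt_neqAle eq_sym u_neq0.
  have tp : 0 < u / (2 * M) by rewrite divr_gt0// mulr_gt0.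
  have := ut _ tp.
  rewrite (_ : _ * M + _ = u / 2 + 2 * M * r / u); last first.
    by field; rewrite !gt_eqF.
  move=> h; have : u / 2 <= 2 * M * r / u by lra.
  by rewrite ler_pdivlMr// => h'; nra.
apply: (@le_lt_trans _ _ ((4 * M)%:E * \esum_(x in [set: Zn]) S2 x)%E).
  apply: (@le_trans _ _ (\esum_(x in [set: Zn]) ((4 * M)%:E * S2 x))%E).
    exact: le_esum.
  by apply: esumZl_le => //; rewrite mulr_ge0// ltW.
apply: lte_mul_pinfty => //; first by rewrite lee_fin mulr_ge0// ltW.
have -> : (\esum_(x in [set: Zn]) S2 x = \esum_(y in [set: Zn])
    \esum_(x in [set: Zn]) (cmod (f y) * cmod (g (x - y)) ^+ 2)%:E)%E.
  have nn (x y : Zn) : (0 <= (cmod (f y) * cmod (g (x - y)) ^+ 2)%:E)%E.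
    by rewrite lee_fin mulr_ge0 ?cmod_ge0// sqr_ge0.
  rewrite /S2 (@esum_esum R _ _ [set: Zn] (fun=> [set: Zn])
    (fun x y => (cmod (f y) * cmod (g (x - y)) ^+ 2)%:E))//.
  rewrite (@esum_esum R _ _ [set: Zn] (fun=> [set: Zn])
    (fun y x => (cmod (f y) * cmod (g (x - y)) ^+ 2)%:E))//.
  apply: (reindex_esum _ _ (fun p : Zn * Zn => (p.2, p.1))); split => //=.
  - by move=> -[? ?] [? ?] _ _ [-> ->].
  - by move=> -[x y] _; exists (y, x).
have gy (y : Zn) : (\esum_(x in [set: Zn]) (cmod (g (x - y)) ^+ 2)%:E
    = ell2_esqnorm g)%E.
  rewrite /ell2_esqnorm [RHS](reindex_esum [set: Zn] _ (fun x => x - y))//.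
  split => //; first by move=> ? ? _ _ /addIr.
  by move=> z _; exists (z + y) => //; rewrite addrK.
have g0 : (0 <= ell2_esqnorm g)%E.
  by apply: esum_ge0 => x _; rewrite lee_fin sqr_ge0.
apply: (@le_lt_trans _ _ ((fine (ell2_esqnorm g))%:E * S1)%E); last first.
  by apply: lte_mul_pinfty => //; rewrite lee_fin fine_ge0.
apply: (@le_trans _ _ (\esum_(y in [set: Zn])
    ((fine (ell2_esqnorm g))%:E * (cmod (f y))%:E))%E); last first.
  apply: esumZl_le; first exact: fine_ge0.
  by move=> y; rewrite lee_fin cmod_ge0.
apply: le_esum => y _; rewrite fineK; last by rewrite ge0_fin_numE.
rewrite muleC -(gy y).
under eq_esum do rewrite EFinM.
by apply: esumZl_le; [exact: cmod_ge0|move=> x; rewrite lee_fin sqr_ge0].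
Qed.

Lemma lambdaE (theta : 'M[R[i]]_n) (f : Zn -> R[i]) (g : ell2) :
  (forall j k, cmod (theta j k) = 1) -> ell1 (fun=> 1) f ->
  lambda theta f g = twconv theta f g :> (Zn -> R[i]).
Proof.
move=> th1 f1; rewrite /lambda [LHS]val_insubd twconv_ell2//.
by case: g.
Qed.

(* The noncommutative torus C^*(theta), realized on l^2(Z^n): the closure of
   lambda(l^1(Z^n)) in operator norm. *)
Definition nctorus (theta : 'M[R[i]]_n) : set (ell2 -> ell2) :=
  [set T | bounded_op T /\
    forall e : R, 0 < e ->
      exists2 f, ell1 (fun=> 1) f & opnorm (T - lambda theta f) < e].

End Ell2.

(* Main.v *)
Require Import Defs.
From mathcomp Require Import all_boot all_order all_algebra.
From mathcomp Require Import all_classical all_reals all_analysis.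
From mathcomp Require Import complex.
Import Order.TTheory GRing.Theory Num.Theory.
Import numFieldNormedType.Exports.
Local Open Scope classical_set_scope.
Local Open Scope ring_scope.
From mathcomp Require Import ring lra.

Set Implicit Arguments.
Unset Strict Implicit.
Unset Printing Implicit Defensive.

(** Let v be the weight exp(a|x|^b) on Z^n.  The proof that l^1_v is
    inverse-closed in C^*(theta) compares two norms of the powers of one
    element, in the manner of Brandenburg.

    Suppose that A = lambda(f), with f in l^1_v, is invertible with inverse T
    in C^*(theta).  Then A is bounded below, and so for a suitable c > 0 the
    operator 1 - c A^* A is a strict contraction of l^2
    ([lambda_contraction]).  Since A^* = lambda(f^* ), this operator is
    lambda(h) with h = delta_0 - c f^* f in l^1_v.  If the Neumann series of h
    converges in l^1_v, then c f^* f has a left inverse s there, g = c s f^*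
    is a left inverse of f, and T = lambda(g) A T = lambda(g)
    ([subexp_inverse_closed]).

    It remains to pass from a bound rho^k on the l^2 norm of the k-th power of
    h to a small norm in l^1_v ([subexp_left_inverse]).  Three facts are
    combined.
    - As t^b is concave with b < 1, the weight satisfies
      v(x+y) <= v(x) v(y)^b + v(x)^b v(y), whence
      ||f f||_v <= 2 ||f||_v ||f||_(v^b) ([subexp_weightD]).
    - The norm with weight v^b interpolates between l^1_v and l^2: for t >= 1,
      ||f||_(v^b) <= ||f||_v / t + D t^q ||f||_2 ([subexp_interpolation]).
      Here 1/v is square summable, because v grows faster than every
      polynomial and the lattice has polynomial growth
      ([nfin_subexp_weight]).
    - With u_k = ||h^(2^k)||_v / rho^(2^k) and t a small power of u_k these
      give u_(k+1) <= C u_k^(2 - g) for some g > 0, so that u_k grows more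
      slowly than rho^(-2^k), and some power of h has norm less than one
      ([brandenburg_small]).  The geometric series of that power converges in
      l^1_v ([neumann_left_inverse]).

    That l^1_v is a Banach algebra contained in the smooth torus follows from
    submultiplicativity of the weights and from the domination of polynomials
    by v. *)

(** * Sums of nonnegative families *)

Section NonnegativeSums.
Variable R : realType.
Implicit Types T U : choiceType.

Definition nsum T (f : T -> R) : \bar R := (\esum_(x in [set: T]) (f x)%:E)%E.

Lemma nsum_ge0 T (f : T -> R) : (forall x, 0 <= f x) -> (0 <= nsum f)%E.
Proof. by move=> f0; apply: esum_ge0 => x _; rewrite lee_fin. Qed.

Lemma le_nsum T (f g : T -> R) : (forall x, f x <= g x) -> (nsum f <= nsum g)%E.
Proof. by move=> fg; apply: le_esum => x _; rewrite lee_fin. Qed.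

Lemma nsum_fin_le T (f g : T -> R) : (forall x, f x <= g x) ->
  (nsum g < +oo)%E -> (nsum f < +oo)%E.
Proof. by move=> fg; apply: le_lt_trans; exact: le_nsum. Qed.

Lemma eq_nsum T (f g : T -> R) : f =1 g -> nsum f = nsum g.
Proof. by move=> fg; apply: eq_esum => x _; rewrite fg. Qed.

Lemma fine_nsumK T (f : T -> R) : (forall x, 0 <= f x) -> (nsum f < +oo)%E ->
  (fine (nsum f))%:E = nsum f.
Proof. by move=> f0 ff; rewrite fineK// ge0_fin_numE// nsum_ge0. Qed.

Lemma fine_nsum_ge0 T (f : T -> R) : (forall x, 0 <= f x) -> 0 <= fine (nsum f).
Proof. by move=> f0; apply: fine_ge0; exact: nsum_ge0. Qed.

Lemma nsumD T (f g : T -> R) : (forall x, 0 <= f x) -> (forall x, 0 <= g x) ->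
  nsum (fun x => f x + g x) = (nsum f + nsum g)%E.
Proof.
by move=> f0 g0; rewrite /nsum -esumD => // *; rewrite ?lee_fin.
Qed.

Lemma nsum0 T : nsum (fun _ : T => 0) = 0%E.
Proof. by apply: esum1. Qed.

Lemma nsumZ T c (f : T -> R) : 0 <= c -> (forall x, 0 <= f x) ->
  nsum (fun x => c * f x) = (c%:E * nsum f)%E.
Proof.
rewrite le_eqVlt => /predU1P[<-|c0] f0.
  by rewrite mul0e -(nsum0 T); apply: eq_nsum => x; rewrite mul0r.
apply/eqP; rewrite eq_le; apply/andP; split.
  rewrite /nsum; under eq_esum do rewrite EFinM.
  by apply: esumZl_le => [|x]; [exact: ltW|rewrite lee_fin].
rewrite -lee_pdivlMl//.
have -> : nsum f = (\esum_(x in [set: T]) (c^-1%:E * (c * f x)%:E))%E.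
  by apply: eq_esum => x _; rewrite -EFinM mulKf// gt_eqF.
apply: esumZl_le => [|x]; first by rewrite invr_ge0 ltW.
by rewrite lee_fin mulr_ge0// ltW.
Qed.

Lemma nsum_ub T (f : T -> R) x : (forall x, 0 <= f x) -> ((f x)%:E <= nsum f)%E.
Proof.
move=> f0; have <- : (\esum_(y in [set x]) (f y)%:E)%E = (f x)%:E.
  by rewrite esum_set1// lee_fin.
rewrite [leRHS](esumID [set x])//; last by move=> *; rewrite lee_fin.
by rewrite setTI leeDl// esum_ge0// => *; rewrite lee_fin.
Qed.

Lemma nsum_reindex T U (e : T -> U) (f : U -> R) : bijective e ->
  nsum (fun x => f (e x)) = nsum f.
Proof.
move=> [e' ee' e'e]; rewrite /nsum [RHS](reindex_esum [set: T] _ e)//.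
split => //; first by move=> x y _ _ /(can_inj ee').
by move=> y _; exists (e' y).
Qed.

Lemma esum_swap T U (F : T -> U -> \bar R) : (forall x y, 0 <= F x y)%E ->
  (\esum_(x in [set: T]) \esum_(y in [set: U]) F x y =
   \esum_(y in [set: U]) \esum_(x in [set: T]) F x y)%E.
Proof.
move=> F0; rewrite (@esum_esum R _ _ [set: T] (fun=> [set: U]))//.
rewrite (@esum_esum R _ _ [set: U] (fun=> [set: T]) (fun y x => F x y))//.
apply: (reindex_esum _ _ (fun p : U * T => (p.2, p.1))); split => //=.
- by move=> -[? ?] [? ?] _ _ [-> ->].
- by move=> -[x y] _; exists (y, x).
Qed.

Lemma nsum_nsum_inner_fin T U (F : T -> U -> R) : (forall x y, 0 <= F x y) ->
  (\esum_(x in [set: T]) nsum (F x) < +oo)%E ->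
  forall x, (nsum (F x) < +oo)%E.
Proof.
move=> F0 Ffin x.
have := @summable_pinfty _ _ [set: T] (fun x => nsum (F x)).
rewrite /summable; under eq_esum do rewrite gee0_abs ?nsum_ge0//.
by move=> /(_ Ffin x I); rewrite gee0_abs ?nsum_ge0.
Qed.

Lemma nsum_fine T U (F : T -> U -> R) : (forall x y, 0 <= F x y) ->
  (\esum_(x in [set: T]) nsum (F x) < +oo)%E ->
  nsum (fun x => fine (nsum (F x))) = (\esum_(x in [set: T]) nsum (F x))%E.
Proof.
move=> F0 Ffin; apply: eq_esum => x _; rewrite fine_nsumK//.
exact: nsum_nsum_inner_fin.
Qed.

Lemma nsum_fin_supp1 T (f : T -> R) x0 : 0 <= f x0 ->
  (forall x, x != x0 -> f x = 0) -> nsum f = (f x0)%:E.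
Proof.
move=> f0 fx; rewrite /nsum (esumID [set x0]); last first.
  by move=> x _; rewrite lee_fin; have [->//|/fx->] := eqVneq x x0.
rewrite setTI esum_set1 ?lee_fin// esum1 ?adde0// => x [_ /= /eqP xx0].
by rewrite fx.
Qed.

Lemma nsum_nsumM (T U : choiceType) (p : T -> R) (q : U -> R) :
  (forall t, 0 <= p t) -> (forall t, 0 <= q t) -> (nsum q < +oo)%E ->
  (\esum_(t in [set: T]) nsum (fun s => (p t * q s)%R))%E = (nsum p * nsum q)%E.
Proof.
move=> p0 q0 qf.
under eq_esum => x _ do rewrite nsumZ// -(fine_nsumK q0 qf) -EFinM mulrC.
by rewrite -/(nsum _) nsumZ ?fine_nsum_ge0// (fine_nsumK q0 qf) muleC.
Qed.

Lemma nsum_le_seq T (f : T -> R) M :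
  (forall s : seq T, uniq s -> \sum_(x <- s) f x <= M) -> (nsum f <= M%:E)%E.
Proof.
move=> fM; apply: ge_ereal_sup => _ [X [finX _] <-].
by rewrite fsumEFin// lee_fin fsbig_finite// fM.
Qed.

Lemma seq_le_nsum T (f : T -> R) (s : seq T) : (forall x, 0 <= f x) -> uniq s ->
  ((\sum_(x <- s) f x)%:E <= nsum f)%E.
Proof.
move=> f0 us; apply: esum_ge; exists [set` s].
  by split => //; exact: finite_seq.
rewrite fsumEFin ?lee_fin; last exact: finite_seq.
by rewrite fsbig_seq.
Qed.

(** Fatou: each finite partial sum passes to the limit. *)
Lemma nsum_fatou T (f : nat -> T -> R) (l : T -> R) M :
  (forall k x, 0 <= f k x) -> (forall x, f k x @[k --> \oo] --> l x) ->
  (\forall k \near \oo, (nsum (f k) <= M%:E)%E) -> (nsum l <= M%:E)%E.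
Proof.
move=> f0 fl fM; apply: nsum_le_seq => s us.
have sl : \sum_(x <- s) f k x @[k --> \oo] --> \sum_(x <- s) l x.
  elim: s {us} => [|x s ih].
    by rewrite big_nil; under eq_fun do rewrite big_nil; exact: cvg_cst.
  by rewrite big_cons; under eq_fun do rewrite big_cons; exact: cvgD.
apply: (cvgr_to_le sl); apply: filterS fM => k.
by rewrite -lee_fin; apply: le_trans; exact: seq_le_nsum.
Qed.

End NonnegativeSums.
Notation nfin f := (nsum f%R < +oo)%E.

(** * Absolutely convergent real sums *)

Section RealSums.
Variable R : realType.
Implicit Types T U : choiceType.

Definition ppart (x : R) := Num.max x 0.
Definition npart (x : R) := Num.max (- x) 0.

Lemma ppart_ge0 x : 0 <= ppart x. Proof. by rewrite /ppart le_max lexx orbT. Qed.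
Lemma npart_ge0 x : 0 <= npart x. Proof. by rewrite /npart le_max lexx orbT. Qed.
Lemma ppartBneg x : x = ppart x - npart x.
Proof. by rewrite /ppart /npart; case: (leP x 0) => ?; case: (leP (- x) 0) => ?; lra. Qed.
Lemma ppartDneg x : `|x| = ppart x + npart x.
Proof.
rewrite /ppart /npart; have [x0|/ltW x0] := leP 0 x.
  by rewrite ger0_norm// max_r ?oppr_le0// addr0.
by rewrite ler0_norm// max_l ?oppr_ge0// add0r.
Qed.
Lemma ppart_le x : ppart x <= `|x|.
Proof. by rewrite ppartDneg lerDl npart_ge0. Qed.
Lemma npart_le x : npart x <= `|x|.
Proof. by rewrite ppartDneg lerDr ppart_ge0. Qed.

(** A real sum can be computed from any decomposition into a difference of two
    summable nonnegative families; linearity and Fubini all follow from this. *)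
Lemma rsumB T (p q : T -> R) : (forall x, 0 <= p x) -> (forall x, 0 <= q x) ->
  (nsum p < +oo)%E -> (nsum q < +oo)%E ->
  rsum (fun x => p x - q x) = fine (nsum p) - fine (nsum q).
Proof.
move=> p0 q0 pf qf; rewrite /rsum.
have -> : EFin \o (fun x => p x - q x) = ((EFin \o p) \- (EFin \o q))%E.
  by apply/funext => x /=; rewrite EFinB.
rewrite esumB.
- by rewrite -/(nsum p) -/(nsum q) fineB// ge0_fin_numE// nsum_ge0.
- rewrite /summable; under eq_esum do rewrite gee0_abs ?lee_fin//.
  exact: pf.
- rewrite /summable; under eq_esum do rewrite gee0_abs ?lee_fin//.
  exact: qf.
- by move=> x _; rewrite lee_fin.
- by move=> x _; rewrite lee_fin.
Qed.

Lemma eq_rsum T (f g : T -> R) : f =1 g -> rsum f = rsum g.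
Proof. by move=> /funext ->. Qed.

Lemma rsumE T (f : T -> R) : nfin (fun x => `|f x|) ->
  rsum f = fine (nsum (fun x => ppart (f x))) - fine (nsum (fun x => npart (f x))).
Proof.
move=> ff; rewrite -rsumB.
- by apply: eq_rsum => x; exact: ppartBneg.
- by move=> x; exact: ppart_ge0.
- by move=> x; exact: npart_ge0.
- by apply: nsum_fin_le ff => x; exact: ppart_le.
- by apply: nsum_fin_le ff => x; exact: npart_le.
Qed.

Lemma rsum_ge0E T (f : T -> R) : (forall x, 0 <= f x) -> (nsum f < +oo)%E ->
  rsum f = fine (nsum f).
Proof.
move=> f0 ff; have := @rsumB T f (fun=> 0) f0 (fun=> lexx _) ff.
rewrite nsum0 /= subr0 => <- //.
by apply: eq_rsum => x; rewrite subr0.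
Qed.

Lemma rsumD T (f g : T -> R) : nfin (fun x => `|f x|) ->
  nfin (fun x => `|g x|) ->
  rsum (fun x => f x + g x) = rsum f + rsum g.
Proof.
move=> ff gf.
have fp : nfin (fun x => ppart (f x)).
  by apply: nsum_fin_le ff => x; exact: ppart_le.
have gp : nfin (fun x => ppart (g x)).
  by apply: nsum_fin_le gf => x; exact: ppart_le.
have fn : nfin (fun x => npart (f x)).
  by apply: nsum_fin_le ff => x; exact: npart_le.
have gn : nfin (fun x => npart (g x)).
  by apply: nsum_fin_le gf => x; exact: npart_le.
rewrite (rsumE ff) (rsumE gf).
rewrite (_ : rsum _ = rsum (fun x => (ppart (f x) + ppart (g x))
  - (npart (f x) + npart (g x)))); last first.
  by apply: eq_rsum => x; rewrite {1}(ppartBneg (f x)) {1}(ppartBneg (g x)); ring.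
have P := ppart_ge0; have N := npart_ge0.
rewrite rsumB.
- rewrite !nsumD// !fineD ?ge0_fin_numE ?nsum_ge0//; ring.
- by move=> x; rewrite addr_ge0.
- by move=> x; rewrite addr_ge0.
- by rewrite nsumD// lte_add_pinfty.
- by rewrite nsumD// lte_add_pinfty.
Qed.

Lemma rsumZ T c (f : T -> R) : nfin (fun x => `|f x|) ->
  rsum (fun x => c * f x) = c * rsum f.
Proof.
move=> ff.
have fp : nfin (fun x => ppart (f x)).
  by apply: nsum_fin_le ff => x; exact: ppart_le.
have fn : nfin (fun x => npart (f x)).
  by apply: nsum_fin_le ff => x; exact: npart_le.
have P := ppart_ge0; have N := npart_ge0.
rewrite (rsumE ff); have [c0|c0] := leP 0 c.
  rewrite (_ : rsum _ = rsum (fun x => c * ppart (f x) - c * npart (f x))).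
    rewrite rsumB => [|x|x||]; rewrite ?mulr_ge0 ?nsumZ ?lte_mul_pinfty//.
    rewrite !fineM ?ge0_fin_numE ?nsum_ge0 ?lte_mul_pinfty ?ltry//=; ring.
  by apply: eq_rsum => x; rewrite {1}(ppartBneg (f x)); ring.
have c0' : 0 <= - c by lra.
rewrite (_ : rsum _ = rsum (fun x => - c * npart (f x) - - c * ppart (f x))).
  rewrite rsumB => [|x|x||]; rewrite ?mulr_ge0 ?nsumZ ?lte_mul_pinfty//.
  rewrite !fineM ?ge0_fin_numE ?nsum_ge0 ?lte_mul_pinfty ?ltry//=; ring.
by apply: eq_rsum => x; rewrite {1}(ppartBneg (f x)); ring.
Qed.

Lemma rsum_norm_le T (f : T -> R) : nfin (fun x => `|f x|) ->
  `|rsum f| <= fine (nsum (fun x => `|f x|)).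
Proof.
move=> ff.
have fp : nfin (fun x => ppart (f x)).
  by apply: nsum_fin_le ff => x; exact: ppart_le.
have fn : nfin (fun x => npart (f x)).
  by apply: nsum_fin_le ff => x; exact: npart_le.
have P := ppart_ge0; have N := npart_ge0.
rewrite rsumE// (eq_nsum (fun x => ppartDneg (f x))) nsumD//.
rewrite fineD ?ge0_fin_numE ?nsum_ge0//.
have := fine_nsum_ge0 (fun x => P (f x)).
have := fine_nsum_ge0 (fun x => N (f x)).
by move=> ? ?; rewrite ler_norml; apply/andP; split; lra.
Qed.

Lemma rsum_reindex T U (e : T -> U) (f : U -> R) : bijective e ->
  rsum (fun x => f (e x)) = rsum f.
Proof.
move=> [e' ee' e'e].
have be : set_bij [set: T] [set: U] e.
  split => //; first by move=> x y _ _ /(can_inj ee').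
  by move=> y _; exists (e' y).
rewrite /rsum; congr (fine (_ - _)); rewrite [RHS](reindex_esum _ _ _ _ be).
  by apply: eq_esum => x _; rewrite !funeposE.
by apply: eq_esum => x _; rewrite !funenegE.
Qed.

Lemma rsum_supp1 T (f : T -> R) x0 :
  (forall x, x != x0 -> f x = 0) -> rsum f = f x0.
Proof.
move=> fx; have nf : nsum (fun x => `|f x|) = `|f x0|%:E.
  by apply: nsum_fin_supp1 => // x /fx ->; rewrite normr0.
rewrite rsumE ?nf ?ltry// (@nsum_fin_supp1 _ _ _ x0) ?ppart_ge0//; last first.
  by move=> x /fx ->; rewrite /ppart maxxx.
rewrite (@nsum_fin_supp1 _ _ _ x0) ?npart_ge0//; last first.
  by move=> x /fx ->; rewrite /npart oppr0 maxxx.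
by rewrite /= -ppartBneg.
Qed.

(** Tonelli, applied to the positive and to the negative parts. *)
Lemma rsum_fubini T U (F : T -> U -> R) :
  (\esum_(x in [set: T]) nsum (fun y => `|F x y|%R) < +oo)%E ->
  rsum (fun x => rsum (F x)) = rsum (fun y => rsum (fun x => F x y)).
Proof.
move=> Ffin.
have P := ppart_ge0; have N := npart_ge0.
have Ffin' : (\esum_(y in [set: U]) nsum (fun x => `|F x y|%R) < +oo)%E.
  by rewrite -esum_swap// => x y; rewrite lee_fin.
have half (V W : choiceType) (G : V -> W -> R) :
    (\esum_(x in [set: V]) nsum (fun y => `|G x y|%R) < +oo)%E ->
    rsum (fun x => rsum (G x)) =
    fine (\esum_(x in [set: V]) nsum (fun y => ppart (G x y)))%E -
    fine (\esum_(x in [set: V]) nsum (fun y => npart (G x y)))%E.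
  move=> Gfin.
  have Gp : (\esum_(x in [set: V]) nsum (fun y => ppart (G x y)) < +oo)%E.
    apply: le_lt_trans Gfin; apply: le_esum => x _; apply: le_nsum => y.
    exact: ppart_le.
  have Gn : (\esum_(x in [set: V]) nsum (fun y => npart (G x y)) < +oo)%E.
    apply: le_lt_trans Gfin; apply: le_esum => x _; apply: le_nsum => y.
    exact: npart_le.
  rewrite -(nsum_fine (fun x y => P (G x y)) Gp).
  rewrite -(nsum_fine (fun x y => N (G x y)) Gn) -rsumB ?nsum_fine//; last 2 first.
  - by move=> x; exact: fine_nsum_ge0.
  - by move=> x; exact: fine_nsum_ge0.
  apply: eq_rsum => x; rewrite rsumE//.
  by apply: (@nsum_nsum_inner_fin _ _ _ (fun x y => `|G x y|%R)).
by rewrite (half _ _ F)// (half _ _ (fun y x => F x y))//;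
  congr (fine _ - fine _); rewrite esum_swap// => x y; rewrite lee_fin.
Qed.

End RealSums.

(** * Absolutely convergent complex sums *)

Section ComplexSums.
Variable R : realType.
Implicit Types T U : choiceType.
Local Notation C := R[i].

(** Absolute summability, the condition under which csum is a sum. *)
Definition asummable T (f : T -> C) := nfin (fun x => cmod (f x)).

Lemma Re_le_cmod (z : C) : `|complex.Re z| <= cmod z.
Proof. by case: z => p q /=; rewrite -sqrtr_sqr ler_wsqrtr// lerDl sqr_ge0. Qed.

Lemma Im_le_cmod (z : C) : `|complex.Im z| <= cmod z.
Proof. by case: z => p q /=; rewrite -sqrtr_sqr ler_wsqrtr// lerDr sqr_ge0. Qed.

Lemma cmodM (z w : C) : cmod (z * w) = cmod z * cmod w.
Proof. exact: ComplexField.Normc.normcM. Qed.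

Lemma cmod0 : cmod (0 : C) = 0. Proof. exact: ComplexField.Normc.normc0. Qed.
Lemma cmod1 : cmod (1 : C) = 1. Proof. exact: ComplexField.Normc.normc1. Qed.

Lemma cmodD (z w : C) : cmod (z + w) <= cmod z + cmod w.
Proof. exact: le_normcD. Qed.

Lemma cmodN (z : C) : cmod (- z) = cmod z.
Proof. exact: normcN. Qed.

Lemma cmod_conj (z : C) : cmod (z^*)%C = cmod z.
Proof. by case: z => p q /=; rewrite sqrrN. Qed.

Lemma cmod_real (c : R) : cmod (c%:C)%C = `|c|.
Proof. by rewrite /= expr0n addr0 sqrtr_sqr. Qed.

Lemma Re_mul (z w : C) :
  complex.Re (z * w) = complex.Re z * complex.Re w - complex.Im z * complex.Im w.
Proof. by case: z w => [a b] [c d]. Qed.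

Lemma Im_mul (z w : C) :
  complex.Im (z * w) = complex.Re z * complex.Im w + complex.Im z * complex.Re w.
Proof. by case: z w => [a b] [c d]. Qed.

Lemma Re_mul_conj (z : C) : complex.Re (z * (z^*)%C) = cmod z ^+ 2.
Proof.
case: z => a b /=; rewrite sqr_sqrtr ?addr_ge0 ?sqr_ge0//.
by rewrite mulrN opprK !expr2.
Qed.

Lemma complex_eq (z w : C) : complex.Re z = complex.Re w ->
  complex.Im z = complex.Im w -> z = w.
Proof. by case: z w => [a b] [c d] /= -> ->. Qed.

Lemma asummable_Re T (f : T -> C) : asummable f ->
  nfin (fun x => `|complex.Re (f x)|).
Proof. by apply: nsum_fin_le => x; exact: Re_le_cmod. Qed.

Lemma asummable_Im T (f : T -> C) : asummable f ->
  nfin (fun x => `|complex.Im (f x)|).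
Proof. by apply: nsum_fin_le => x; exact: Im_le_cmod. Qed.

Lemma asummableZ T c (f : T -> C) : asummable f -> asummable (fun x => c * f x).
Proof.
rewrite /asummable => ff; rewrite (eq_nsum (fun x => cmodM c (f x))).
have c0 := cmod_ge0 c; have f0 x := cmod_ge0 (f x).
by rewrite nsumZ// lte_mul_pinfty.
Qed.

Lemma eq_csum T (f g : T -> C) : f =1 g -> csum f = csum g.
Proof. by move=> /funext ->. Qed.

Lemma csumD T (f g : T -> C) : asummable f -> asummable g ->
  csum (fun x => f x + g x) = csum f + csum g.
Proof.
move=> ff gf; apply: complex_eq => /=.
  rewrite -(rsumD (asummable_Re ff) (asummable_Re gf)).
  by apply: eq_rsum => x; case: (f x) (g x) => [? ?] [? ?].
rewrite -(rsumD (asummable_Im ff) (asummable_Im gf)).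
by apply: eq_rsum => x; case: (f x) (g x) => [? ?] [? ?].
Qed.

Lemma csumZ T c (f : T -> C) : asummable f ->
  csum (fun x => c * f x) = c * csum f.
Proof.
move=> ff; have fR := asummable_Re ff; have fI := asummable_Im ff.
have sZ (r : R) (g : T -> R) : nfin (fun x => `|g x|) ->
    nfin (fun x => `|r * g x|).
  move=> gf; rewrite (eq_nsum (fun x => normrM r (g x))) nsumZ//.
  by rewrite lte_mul_pinfty// lee_fin.
apply: complex_eq; rewrite ?Re_mul ?Im_mul /csum.
  rewrite [LHS]/= [complex.Re (_ +i* _)%C]/= [complex.Im (_ +i* _)%C]/=.
  rewrite -(rsumZ _ fR) -mulNr -(rsumZ _ fI).
  rewrite -(rsumD (sZ _ _ fR) (sZ _ _ fI)).
  by apply: eq_rsum => x; rewrite Re_mul mulNr.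
rewrite [LHS]/= [complex.Re (_ +i* _)%C]/= [complex.Im (_ +i* _)%C]/=.
rewrite -(rsumZ _ fI) -(rsumZ _ fR) -(rsumD (sZ _ _ fI) (sZ _ _ fR)).
by apply: eq_rsum => x; rewrite Im_mul.
Qed.

Lemma csum_conj T (f : T -> C) : asummable f ->
  csum (fun x => (f x)^*%C) = ((csum f)^*)%C.
Proof.
move=> ff; apply: complex_eq => /=.
  by apply: eq_rsum => x; case: (f x).
rewrite -mulN1r -(rsumZ _ (asummable_Im ff)).
by apply: eq_rsum => x; rewrite mulN1r; case: (f x).
Qed.

Lemma csum_reindex T U (e : T -> U) (f : U -> C) : bijective e ->
  csum (fun x => f (e x)) = csum f.
Proof.
move=> be; rewrite /csum; congr (_ +i* _)%C.
  exact: (rsum_reindex (fun x => complex.Re (f x)) be).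
exact: (rsum_reindex (fun x => complex.Im (f x)) be).
Qed.

Lemma csum_supp1 T (f : T -> C) x0 :
  (forall x, x != x0 -> f x = 0) -> csum f = f x0.
Proof.
by move=> fx; rewrite /csum; apply: complex_eq => /=;
  rewrite (@rsum_supp1 _ _ _ x0)// => x /fx ->.
Qed.

Lemma csum_fubini T U (F : T -> U -> C) :
  (\esum_(x in [set: T]) nsum (fun y => cmod (F x y)) < +oo)%E ->
  csum (fun x => csum (F x)) = csum (fun y => csum (fun x => F x y)).
Proof.
move=> Ffin; apply: complex_eq => /=; apply: rsum_fubini;
  apply: le_lt_trans Ffin; apply: le_esum => x _; apply: le_nsum => y.
  exact: Re_le_cmod.
exact: Im_le_cmod.
Qed.

(** Rotating by the phase of the sum makes the sum real and positive, which
    reduces the triangle inequality to the one for real parts. *)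
Lemma cmod_csum_le T (f : T -> C) :
  ((cmod (csum f))%:E <= nsum (fun x => cmod (f x)))%E.
Proof.
have [|ff] := leP (+oo)%E (nsum (fun x => cmod (f x))).
  by rewrite leye_eq => /eqP ->; rewrite leey.
rewrite -[leRHS]fine_nsumK// ?lee_fin; last by move=> x; exact: cmod_ge0.
set z := csum f; set S := fine _.
have [->|z0] := eqVneq (cmod z) 0.
  by rewrite fine_nsum_ge0// => x; exact: cmod_ge0.
have zp : 0 < cmod z by rewrite lt_neqAle eq_sym z0 cmod_ge0.
rewrite -(ler_pM2l zp) -expr2 -Re_mul_conj mulrC -csumZ//.
rewrite (le_trans (ler_norm _))//.
have sf := asummableZ (z^*)%C ff.
apply: (le_trans (rsum_norm_le (asummable_Re sf))).
rewrite /S -[X in X * _]/(fine (cmod z)%:E) -fineM//; last first.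
  by rewrite ge0_fin_numE// nsum_ge0// => x; exact: cmod_ge0.
rewrite -nsumZ ?cmod_ge0//; last by move=> x; exact: cmod_ge0.
apply: fine_le.
- rewrite ge0_fin_numE ?nsum_ge0//; exact: asummable_Re.
- rewrite nsumZ ?cmod_ge0//; last by move=> x; exact: cmod_ge0.
  rewrite fin_numM// ge0_fin_numE// nsum_ge0// => x; exact: cmod_ge0.
apply: le_nsum => x; rewrite (le_trans (Re_le_cmod _))//.
by rewrite cmodM cmod_conj.
Qed.

Lemma asummable_mul_bounded T (f g : T -> C) B :
  asummable f -> (forall x, cmod (g x) <= B) -> asummable (fun x => f x * g x).
Proof.
move=> ff gB; apply: (@nsum_fin_le _ _ _ (fun x => `|B| * cmod (f x))).
  move=> x; rewrite cmodM mulrC ler_wpM2r ?cmod_ge0//.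
  by rewrite (le_trans (gB x))// ler_norm.
have B0 := normr_ge0 B; have c0 x := cmod_ge0 (f x).
by rewrite nsumZ// lte_mul_pinfty.
Qed.

End ComplexSums.

(** * Twisted convolution on weighted l^1 spaces *)

Section TwistedAlgebra.
Variables (R : realType) (n : nat) (theta : 'M[R[i]]_n).
Hypothesis theta_circle : forall j k, cmod (theta j k) = 1.
Local Notation C := R[i].
Local Notation Zn := 'rV[int]_n.
Local Notation sg := (sigma theta).
Local Notation tw := (twconv theta).
Implicit Types (f g h : Zn -> C) (w : Zn -> R) (x y z : Zn).

Lemma cmod1_neq0 (z : C) : cmod z = 1 -> z != 0.
Proof.
by move=> z1; apply: contra_eq_neq z1 => ->; rewrite cmod0 eq_sym oner_neq0.
Qed.

Lemma sigmaDl x y z : sg (x + y) z = sg x z * sg y z.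
Proof.
rewrite /sigma -big_split; apply: eq_bigr => j _.
rewrite -big_split; apply: eq_bigr => k _.
by rewrite mxE mulrDl expfzDr// cmod1_neq0.
Qed.

Lemma sigmaDr x y z : sg x (y + z) = sg x y * sg x z.
Proof.
rewrite /sigma -big_split; apply: eq_bigr => j _.
rewrite -big_split; apply: eq_bigr => k _.
by rewrite mxE mulrDr expfzDr// cmod1_neq0.
Qed.

Lemma sigma_neq0 x y : sg x y != 0.
Proof. by apply: cmod1_neq0; exact: cmod_sigma. Qed.

Lemma sigma0l x : sg 0 x = 1.
Proof.
by apply: (mulfI (sigma_neq0 0 x)); rewrite -sigmaDl addr0 mulr1.
Qed.

Lemma sigma0r x : sg x 0 = 1.
Proof.
by apply: (mulfI (sigma_neq0 x 0)); rewrite -sigmaDr addr0 mulr1.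
Qed.

Lemma sigmaNl x y : sg (- x) y * sg x y = 1.
Proof. by rewrite -sigmaDl addNr sigma0l. Qed.

Lemma cmod1_conj (z : C) : cmod z = 1 -> z * (z^*)%C = 1.
Proof.
move=> z1; apply: complex_eq; first by rewrite Re_mul_conj z1 expr1n.
by case: z {z1} => a b /=; ring.
Qed.

(** The cocycle has modulus one, so it disappears from all estimates. *)
Lemma cmod_twterm f g x y :
  cmod (f y * g (x - y) * sg y (x - y)) = cmod (f y) * cmod (g (x - y)).
Proof. by rewrite !cmodM cmod_sigma// mulr1. Qed.

Lemma cmod_twconv_le f g x :
  ((cmod (tw f g x))%:E <= nsum (fun y => (cmod (f y) * cmod (g (x - y)))%R))%E.
Proof.
apply: (le_trans (cmod_csum_le _)).
by rewrite (eq_nsum (fun y => cmod_twterm f g x y)).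
Qed.

Lemma subr_bij x : bijective (fun y : Zn => y - x).
Proof. by exists (fun y => y + x) => y; rewrite ?subrK ?addrK. Qed.

Lemma addr_bij x : bijective (fun y : Zn => y + x).
Proof. by exists (fun y => y - x) => y; rewrite ?subrK ?addrK. Qed.

Lemma ell1_enorm_ge0 w f : (forall x, 0 <= w x) -> (0 <= ell1_enorm w f)%E.
Proof. by move=> w0; apply: nsum_ge0 => x; rewrite mulr_ge0// cmod_ge0. Qed.

(** Tonelli and the substitution x = y + z.  Bounds of w (y + z) by products of
    weights turn this into norm bounds. *)
Lemma ell1_twconv_young w f g : (forall x, 0 <= w x) ->
  (ell1_enorm w (tw f g) <=
   \esum_(y in [set: Zn])
     nsum (fun z => (cmod (f y) * cmod (g z) * w (y + z))%R))%E.
Proof.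
move=> w0; have c0 (z : C) := cmod_ge0 z.
apply: (@le_trans _ _ (\esum_(x in [set: Zn])
    nsum (fun y => (cmod (f y) * cmod (g (x - y)) * w x)%R))%E).
  apply: le_esum => x _; rewrite (_ : nsum _ =
      ((w x)%:E * nsum (fun y => (cmod (f y) * cmod (g (x - y)))%R))%E).
    by rewrite mulrC EFinM lee_wpmul2l ?lee_fin ?w0// cmod_twconv_le.
  rewrite -nsumZ//; last by move=> y; rewrite mulr_ge0.
  by apply: eq_nsum => y; rewrite mulrC.
rewrite esum_swap; last by move=> x y; rewrite lee_fin !mulr_ge0.
apply: le_esum => y _.
rewrite -/(nsum (fun x => cmod (f y) * cmod (g (x - y)) * w x)).
rewrite -(nsum_reindex _ (addr_bij y)).
by apply: le_nsum => z; rewrite addrK [y + z]addrC.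
Qed.

Lemma ell1_twconvM w w1 w2 f g : (forall x, 0 <= w x) ->
  (forall x, 0 <= w1 x) -> (forall x, 0 <= w2 x) ->
  (forall x y, w (x + y) <= w1 x * w2 y) -> ell1 w2 g ->
  (ell1_enorm w (tw f g) <= ell1_enorm w1 f * ell1_enorm w2 g)%E.
Proof.
move=> w0 w10 w20 ww gfin; have c0 (z : C) := cmod_ge0 z.
apply: (le_trans (ell1_twconv_young _ _ w0)).
rewrite -[leRHS]nsum_nsumM//; last 2 first.
- by move=> x; rewrite mulr_ge0.
- by move=> x; rewrite mulr_ge0.
apply: le_esum => y _; apply: le_nsum => z.
rewrite [leRHS](_ : _ = cmod (f y) * cmod (g z) * (w1 y * w2 z)); last by ring.
by rewrite ler_wpM2l// mulr_ge0.
Qed.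

(** The form taken by the norm bound when the weight is only controlled by two
    products; it yields the bound on squares in terms of a smaller weight. *)
Lemma ell1_twconvM2 w w1 w2 w3 w4 f g : (forall x, 0 <= w x) ->
  (forall x, 0 <= w1 x) -> (forall x, 0 <= w2 x) ->
  (forall x, 0 <= w3 x) -> (forall x, 0 <= w4 x) ->
  (forall x y, w (x + y) <= w1 x * w2 y + w3 x * w4 y) ->
  ell1 w2 g -> ell1 w4 g ->
  (ell1_enorm w (tw f g) <= ell1_enorm w1 f * ell1_enorm w2 g
     + ell1_enorm w3 f * ell1_enorm w4 g)%E.
Proof.
move=> w0 w10 w20 w30 w40 ww g2 g4; have c0 (z : C) := cmod_ge0 z.
have m0 (u v : R) : 0 <= u -> 0 <= v -> 0 <= u * v by exact: mulr_ge0.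
apply: (le_trans (ell1_twconv_young _ _ w0)).
rewrite /ell1_enorm -(nsum_nsumM _ _ g2); do ?by [move=> x; exact: m0].
rewrite -(nsum_nsumM _ _ g4); do ?by [move=> x; exact: m0].
rewrite -esumD; do ?by move=> x _; apply: nsum_ge0 => y; rewrite !m0.
apply: le_esum => y _; rewrite -nsumD; do ?by move=> x; rewrite !m0.
apply: le_nsum => z.
rewrite [leRHS](_ : _ = cmod (f y) * cmod (g z) *
  (w1 y * w2 z + w3 y * w4 z)); last by ring.
by rewrite ler_wpM2l// mulr_ge0.
Qed.

Definition cbounded f := exists B : R, forall x, cmod (f x) <= B.

Lemma ell1_cbounded f : ell1 (fun=> 1) f -> cbounded f.
Proof.
move=> ff; pose p x := cmod (f x) * 1.
have p0 x : 0 <= p x by rewrite /p mulr1 cmod_ge0.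
exists (fine (nsum p)) => x; rewrite -lee_fin fine_nsumK//.
by rewrite -[cmod (f x)]mulr1; exact: nsum_ub x p0.
Qed.

Lemma ell1_asummable f : ell1 (fun=> 1) f -> asummable f.
Proof.
by apply: (@nsum_fin_le _ _ _ (fun x => cmod (f x) * 1)) => x; rewrite mulr1.
Qed.

Lemma asummable_twterm f g x : ell1 (fun=> 1) f -> cbounded g ->
  asummable (fun y => f y * g (x - y) * sg y (x - y)).
Proof.
move=> /ell1_asummable ff [B gB].
apply: (@nsum_fin_le _ _ _ (fun y => cmod (f y * g (x - y)))).
  by move=> y; rewrite cmod_twterm cmodM.
exact: (asummable_mul_bounded ff (fun y => gB (x - y))).
Qed.

(** Fubini, and the cocycle identity of sigma.  The third factor is taken
    bounded rather than summable, so that the statement covers associativity in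
    l^1 and also multiplicativity of the regular representation on l^2. *)
Lemma twconvA f g h : ell1 (fun=> 1) f -> ell1 (fun=> 1) g -> cbounded h ->
  tw f (tw g h) = tw (tw f g) h.
Proof.
move=> f1 g1 hb; apply/funext => x; rewrite /twconv.
have [B hB] := hb.
have c0 (z : C) := cmod_ge0 z.
have B0 : 0 <= B := le_trans (c0 _) (hB 0).
have fs := ell1_asummable f1; have gs := ell1_asummable g1.
(* the common summand of the two double sums, with y the index of the product f g *)
pose F y z := f z * (g (y - z) * h (x - y)) * (sg z (y - z) * sg y (x - y)).
have cF y z : cmod (F y z) <= B * (cmod (f z) * cmod (g (y - z))).
  rewrite !cmodM !cmod_sigma// !mulr1 mulrA [leRHS]mulrC ler_wpM2l//.
  by rewrite mulr_ge0.
transitivity (csum (fun z => csum (fun y => F y z))).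
  apply: eq_csum => z.
  rewrite -mulrA [_ * sg z (x - z)]mulrC mulrA -csumZ; last first.
    exact: asummable_twterm.
  rewrite -(csum_reindex _ (subr_bij z)); apply: eq_csum => y; rewrite /F.
  have -> : x - z - (y - z) = x - y by rewrite opprB addrA subrK.
  have -> : sg z (x - z) = sg z (x - y) * sg z (y - z).
    by rewrite -sigmaDr addrA subrK.
  have -> : sg y (x - y) = sg (y - z) (x - y) * sg z (x - y).
    by rewrite -sigmaDl subrK.
  by ring.
transitivity (csum (fun y => csum (fun z => F y z))); last first.
  apply: eq_csum => y.
  rewrite -mulrA [RHS]mulrC -csumZ; last first.
    by apply: asummable_twterm => //; exact: ell1_cbounded.
  by apply: eq_csum => z; rewrite /F; ring.
symmetry; apply: csum_fubini.
rewrite esum_swap; last by move=> *; rewrite lee_fin.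
apply: (@le_lt_trans _ _ (\esum_(z in [set: Zn]) nsum
    (fun y => (B * cmod (f z) * cmod (g y))%R))%E).
  apply: le_esum => z _.
  rewrite -(nsum_reindex (fun y => B * cmod (f z) * cmod (g y)) (subr_bij z)).
  by apply: le_nsum => y; rewrite -mulrA.
rewrite nsum_nsumM//; last by move=> z; rewrite mulr_ge0.
rewrite nsumZ// -(fine_nsumK _ fs)// -(fine_nsumK _ gs)//.
by rewrite -!EFinM ltry.
Qed.

Lemma twconv_linl (c : C) f g h :
  ell1 (fun=> 1) f -> ell1 (fun=> 1) g -> cbounded h ->
  tw (c *: f + g) h = c *: tw f h + tw g h.
Proof.
move=> f1 g1 hb; apply/funext => x.
have fs := asummable_twterm x f1 hb; have gs := asummable_twterm x g1 hb.
rewrite [RHS](_ : _ = c * tw f h x + tw g h x)//.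
rewrite /twconv -(csumZ c fs) -(csumD (asummableZ c fs) gs).
apply: eq_csum => y.
by rewrite -[(c *: f + g) y]/(c * f y + g y); ring.
Qed.

Lemma twconv_linr (c : C) f g h :
  ell1 (fun=> 1) h -> cbounded f -> cbounded g ->
  tw h (c *: f + g) = c *: tw h f + tw h g.
Proof.
move=> h1 fb gb; apply/funext => x.
have fs := asummable_twterm x h1 fb; have gs := asummable_twterm x h1 gb.
rewrite [RHS](_ : _ = c * tw h f x + tw h g x)//.
rewrite /twconv -(csumZ c fs) -(csumD (asummableZ c fs) gs).
apply: eq_csum => y.
by rewrite -[(c *: f + g) (x - y)]/(c * f (x - y) + g (x - y)); ring.
Qed.

Lemma twconv1l f : tw (@delta0 R n) f = f.
Proof.
apply/funext => x; rewrite /twconv (@csum_supp1 _ _ _ 0).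
  by rewrite /delta0 eqxx mul1r subr0 sigma0l mulr1.
by move=> y y0; rewrite /delta0 (negbTE y0) !mul0r.
Qed.

Lemma twconv1r f : tw f (@delta0 R n) = f.
Proof.
apply/funext => x; rewrite /twconv (@csum_supp1 _ _ _ x).
  by rewrite /delta0 subrr eqxx mulr1 sigma0r mulr1.
by move=> y yx; rewrite /delta0 subr_eq0 eq_sym (negbTE yx) mulr0 mul0r.
Qed.

Lemma ell1_enorm_delta0 w : (forall x, 0 <= w x) ->
  ell1_enorm w (@delta0 R n) = (w 0)%:E.
Proof.
move=> w0; rewrite /ell1_enorm -[LHS]/(nsum _) (@nsum_fin_supp1 _ _ _ 0).
- by rewrite /delta0 eqxx cmod1 mul1r.
- by rewrite mulr_ge0// cmod_ge0.
- by move=> x x0; rewrite /delta0 (negbTE x0) cmod0 mul0r.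
Qed.

Lemma ell1_enorm0 w : ell1_enorm w (0 : Zn -> C) = 0%E.
Proof.
by rewrite /ell1_enorm -[RHS](nsum0 R Zn); apply: eq_nsum => x; rewrite cmod0 mul0r.
Qed.

Lemma ell1_enormZ w (c : C) f : (forall x, 0 <= w x) ->
  ell1_enorm w (c *: f) = ((cmod c)%:E * ell1_enorm w f)%E.
Proof.
move=> w0; rewrite /ell1_enorm -nsumZ ?cmod_ge0//; last first.
  by move=> x; rewrite mulr_ge0// cmod_ge0.
by apply: eq_nsum => x; rewrite -[(c *: f) x]/(c * f x) cmodM mulrA.
Qed.

Lemma ell1_enormD w f g : (forall x, 0 <= w x) ->
  (ell1_enorm w (f + g)%R <= ell1_enorm w f + ell1_enorm w g)%E.
Proof.
move=> w0; have m0 (h : Zn -> C) x : 0 <= cmod (h x) * w x.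
  by rewrite mulr_ge0// cmod_ge0.
rewrite /ell1_enorm -nsumD//; apply: le_nsum => x.
by rewrite -mulrDl ler_wpM2r// cmodD.
Qed.

Lemma ell1_lin w (c : C) f g : (forall x, 0 <= w x) ->
  ell1 w f -> ell1 w g -> ell1 w (c *: f + g).
Proof.
move=> w0 ff gf; apply: (le_lt_trans (ell1_enormD _ _ w0)).
rewrite ell1_enormZ// lte_add_pinfty// lte_mul_pinfty//.
by rewrite lee_fin cmod_ge0.
Qed.

Lemma ell1_le w w' D f : (forall x, w x <= D * w' x) -> 0 <= D ->
  (forall x, 0 <= w' x) -> ell1 w' f -> ell1 w f.
Proof.
move=> ww D0 w0 ff.
apply: (@nsum_fin_le _ _ _ (fun x => D * (cmod (f x) * w' x))).
  by move=> x; rewrite mulrCA ler_wpM2l// cmod_ge0.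
rewrite nsumZ ?lte_mul_pinfty// => x.
by rewrite mulr_ge0// cmod_ge0.
Qed.

Section Weighted.
Variable w : Zn -> R.
Hypothesis w_ge1 : forall x, 1 <= w x.
Hypothesis w_submul : forall x y, w (x + y) <= w x * w y.

Let w_ge0 x : 0 <= w x. Proof. by rewrite (le_trans _ (w_ge1 x)). Qed.

Lemma ell1_sub1 f : ell1 w f -> ell1 (fun=> 1) f.
Proof. by apply: (@ell1_le _ _ 1) => // x; rewrite mul1r. Qed.

Lemma ell1_algebra : is_algebra tw (@delta0 R n) (ell1 w).
Proof.
split.
- by rewrite /ell1/= ell1_enorm_delta0// ltry.
- by move=> c f g ff gf; exact: ell1_lin.
- move=> f g ff gf; apply: (le_lt_trans (ell1_twconvM f _ _ _ w_submul gf)) => //.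
  by rewrite lte_mul_pinfty ?ell1_enorm_ge0// ge0_fin_numE ?ell1_enorm_ge0.
- move=> f g h /ell1_sub1 f1 /ell1_sub1 g1 /ell1_sub1 /ell1_cbounded hb.
  exact: twconvA.
- by move=> f _; exact: twconv1l.
- by move=> f _; exact: twconv1r.
- move=> c f g h /ell1_sub1 f1 /ell1_sub1 g1 /ell1_sub1 /ell1_cbounded hb.
  exact: twconv_linl.
- move=> c f g h /ell1_sub1/ell1_cbounded fb /ell1_sub1/ell1_cbounded gb /ell1_sub1 h1.
  exact: twconv_linr.
Qed.

Lemma ell1_normK f : ell1 w f -> (ell1_norm w f)%:E = ell1_enorm w f.
Proof.
by move=> ff; rewrite fineK// ge0_fin_numE ?ell1_enorm_ge0.
Qed.

Lemma ell1_norm_le f c : (ell1_enorm w f <= c%:E)%E ->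
  ell1 w f /\ ell1_norm w f <= c.
Proof.
move=> fc; have ff : ell1 w f by apply: (le_lt_trans fc); rewrite ltry.
by split => //; rewrite -lee_fin ell1_normK.
Qed.

Lemma ell1_norm_ge0 f : 0 <= ell1_norm w f.
Proof. by rewrite fine_ge0// ell1_enorm_ge0. Qed.

Lemma cmod_le_ell1_norm f x : ell1 w f -> cmod (f x) <= ell1_norm w f.
Proof.
move=> ff; rewrite -lee_fin ell1_normK//.
apply: le_trans (nsum_ub x _); last by move=> y; rewrite mulr_ge0// cmod_ge0.
by rewrite lee_fin ler_peMr// cmod_ge0.
Qed.

(** The pointwise limit of a Cauchy sequence; the norm estimate passes to the
    limit on each finite set of indices, hence on the whole lattice. *)
Lemma ell1_complete (u : nat -> Zn -> C) : (forall k, ell1 w (u k)) ->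
  (forall e : R, 0 < e -> exists N : nat, forall p q : nat,
     (N <= p)%N -> (N <= q)%N -> ell1_norm w (u p - u q) < e) ->
  exists2 l, ell1 w l & ell1_norm w (u k - l) @[k --> \oo] --> (0 : R).
Proof.
move=> uw uC.
have subw f g : ell1 w f -> ell1 w g -> ell1 w (f - g).
  by move=> ff gf; rewrite addrC -scaleN1r; exact: ell1_lin.
have w0 := w_ge0; have c0 (z : C) := cmod_ge0 z.
have ucvg (pr : C -> R) : (forall t, `|pr t| <= cmod t) ->
    {morph pr : s t / s - t} ->
    exists a : Zn -> R, forall x, pr (u k x) @[k --> \oo] --> a x.
  move=> prle prB.
  suff /boolp.choice[a ha] : forall x, exists a : R, pr (u k x) @[k --> \oo] --> a.
    by exists a.
  move=> x; apply/cvg_ex/cauchy_cvgP/cauchy_exP => e e0.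
  have [N uN] := uC e e0; exists (pr (u N x)); exists N => // k /= Nk.
  rewrite -ball_normE/= -prB (le_lt_trans (prle _))//.
  apply: le_lt_trans (uN _ _ (leqnn N) Nk).
  exact: (cmod_le_ell1_norm x (subw _ _ (uw N) (uw k))).
have [lr ulr] := ucvg _ (@Re_le_cmod R) ltac:(by move=> [? ?] [? ?]).
have [li uli] := ucvg _ (@Im_le_cmod R) ltac:(by move=> [? ?] [? ?]).
pose l x := (lr x +i* li x)%C.
have ul p x : cmod (u p x - u q x) * w x @[q --> \oo] -->
    cmod (u p x - l x) * w x.
  apply: cvgM; last exact: cvg_cst.
  have E (z t : C) : cmod (z - t) = Num.sqrt
    ((complex.Re z - complex.Re t) ^+ 2 + (complex.Im z - complex.Im t) ^+ 2).
    by case: z t => [? ?] [? ?].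
  rewrite E; under eq_fun do rewrite E.
  apply: (@continuous_cvg _ _ _ _ _ _ Num.sqrt); first exact: sqrt_continuous.
  by apply: cvgD; apply: (@continuous_cvg _ _ _ _ _ _ (fun t : R => t ^+ 2));
    do ?[exact: exprn_continuous]; apply: cvgB; do ?[exact: cvg_cst].
have main e : 0 < e -> exists N, forall p, (N <= p)%N ->
    (ell1_enorm w (u p - l)%R <= e%:E)%E.
  move=> e0; have [N uN] := uC e e0; exists N => p Np.
  apply: (nsum_fatou (f := fun q x => cmod (u p x - u q x) * w x)) => //.
  - by move=> q x; rewrite mulr_ge0.
  - exists N => // q /= Nq; apply: (@le_trans _ _ (ell1_norm w (u p - u q)%R)%:E).
      by rewrite ell1_normK//; exact: subw.
    by rewrite lee_fin ltW// uN.
have [N uN] := main 1 ltr01.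
have lw : ell1 w l.
  have [ulN _] := ell1_norm_le (uN N (leqnn N)).
  by have := subw _ _ (uw N) ulN; rewrite subKr.
exists l => //; apply/cvgrPdist_le => e e0.
have [M uM] := main e e0; exists M => // k /= Mk.
by rewrite sub0r normrN ger0_norm ?ell1_norm_ge0//; have [] := ell1_norm_le (uM k Mk).
Qed.

Lemma ell1_banach : w 0 = 1 ->
  is_banach_algebra tw (@delta0 R n) (ell1_norm w) (ell1 w).
Proof.
move=> w1; have c0 (z : C) := cmod_ge0 z; have w0 := w_ge0.
split.
- exact: ell1_algebra.
- move=> f ff f0; apply/funext => x.
  have := cmod_le_ell1_norm x ff; rewrite f0 => h.
  by apply: ComplexField.Normc.eq0_normc; apply/eqP; rewrite eq_le h c0.
- move=> f g ff gf; have := ell1_norm_le (c := ell1_norm w f + ell1_norm w g).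
  by move=> /(_ (f + g)) []//; rewrite EFinD !ell1_normK// ell1_enormD.
- move=> c f ff; apply/EFin_inj; rewrite EFinM !ell1_normK//.
    exact: ell1_enormZ.
  by rewrite -[_ *: _]addr0; apply: ell1_lin => //; rewrite /ell1/= ell1_enorm0.
- move=> f g ff gf; have := ell1_norm_le (c := ell1_norm w f * ell1_norm w g).
  move=> /(_ (tw f g)) []//; rewrite EFinM !ell1_normK//.
  exact: ell1_twconvM.
- by apply/EFin_inj; rewrite /ell1_norm ell1_enorm_delta0// w1.
- exact: ell1_complete.
Qed.

End Weighted.
End TwistedAlgebra.

(** * Geometric series in a Banach algebra *)

Section Neumann.
Variables (R : realType) (E : lmodType R[i]).
Variables (mul : E -> E -> E) (one : E) (nrm : E -> R) (A : set E).
Hypothesis BA : is_banach_algebra mul one nrm A.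
Local Notation pw x k := (iter k (mul x) one).
Local Notation psum x N := (\sum_(i < N) pw x i).

Let AA := ban_alg BA.

Lemma alg_0 : A 0.
Proof.
by have := alg_lin AA (-1) (alg_one AA) (alg_one AA); rewrite scaleN1r addNr.
Qed.

Lemma alg_add f g : A f -> A g -> A (f + g).
Proof. by move=> Af Ag; have := alg_lin AA 1 Af Ag; rewrite scale1r. Qed.

Lemma alg_sub f g : A f -> A g -> A (f - g).
Proof.
by move=> Af Ag; have := alg_lin AA (-1) Ag Af; rewrite scaleN1r addrC.
Qed.

Lemma alg_mulDl f g h : A f -> A g -> A h ->
  mul (f + g) h = mul f h + mul g h.
Proof. by move=> ? ? ?; rewrite -{1}[f]scale1r (alg_linl AA) ?scale1r. Qed.

Lemma alg_mulBl f g h : A f -> A g -> A h ->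
  mul (f - g) h = mul f h - mul g h.
Proof.
move=> Af Ag Ah; rewrite addrC -scaleN1r (alg_linl AA)// scaleN1r.
by rewrite addrC.
Qed.

Lemma alg_mulBr f g h : A f -> A g -> A h ->
  mul h (f - g) = mul h f - mul h g.
Proof.
move=> Af Ag Ah; rewrite addrC -scaleN1r (alg_linr AA)// scaleN1r.
by rewrite addrC.
Qed.

Lemma alg_pow x k : A x -> A (pw x k).
Proof. by move=> Ax; elim: k => [|k ih]; [exact: (alg_one AA)|exact: (alg_mul AA)]. Qed.

Lemma alg_psum x N : A x -> A (psum x N).
Proof.
move=> Ax; elim: N => [|N ih]; first by rewrite big_ord0; exact: alg_0.
by rewrite big_ord_recr; apply: alg_add => //; exact: alg_pow.
Qed.

Lemma alg_powSr x k : A x -> mul (pw x k) x = pw x k.+1.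
Proof.
move=> Ax; elim: k => [|k ih]; first by rewrite /= (alg_mul1l AA)// (alg_mul1r AA).
rewrite iterS -(alg_mulA AA)//; last exact: alg_pow.
by rewrite ih.
Qed.

Lemma alg_powD x k m : A x -> mul (pw x k) (pw x m) = pw x (k + m).
Proof.
move=> Ax; elim: k => [|k ih]; first by rewrite (alg_mul1l AA)//; exact: alg_pow.
by rewrite addSn !iterS -(alg_mulA AA) ?ih//; exact: alg_pow.
Qed.

(** Telescoping: x commutes with its powers. *)
Lemma alg_geometric x N : A x -> mul (psum x N) (one - x) = one - pw x N.
Proof.
move=> Ax; have A1 := alg_one AA.
have A1x : A (one - x) by exact: alg_sub.
elim: N => [|N ih].
  rewrite big_ord0 subrr -[X in mul X _](subrr one) alg_mulBl//.
  by rewrite subrr.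
have Ap := alg_pow N Ax.
rewrite big_ord_recr/= alg_mulDl ?ih//; last exact: alg_psum.
by rewrite alg_mulBr// (alg_mul1r AA)// alg_powSr// addrA subrK.
Qed.

Lemma ban_norm0 : nrm 0 = 0.
Proof.
by have := ban_normZ BA 0 alg_0; rewrite scaler0 cmod0 mul0r.
Qed.

Lemma ban_normB f g : A f -> A g -> nrm (f - g) = nrm (g - f).
Proof.
move=> Af Ag; have := ban_normZ BA (-1) (alg_sub Ag Af).
by rewrite scaleN1r opprB cmodN cmod1 mul1r.
Qed.

Lemma ban_norm_ge0 f : A f -> 0 <= nrm f.
Proof.
move=> Af; have := ban_normD BA Af (alg_sub alg_0 Af).
rewrite sub0r subrr ban_norm0 -[- f]sub0r ban_normB//; last exact: alg_0.
by rewrite subr0; lra.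
Qed.

Lemma ban_norm_pow x k : A x -> nrm (pw x k) <= nrm x ^+ k.
Proof.
move=> Ax; elim: k => [|k ih]; first by rewrite (ban_norm1 BA).
rewrite iterS exprS (le_trans (ban_normM BA Ax (alg_pow k Ax)))//.
by rewrite ler_wpM2l// ban_norm_ge0.
Qed.

Lemma small_expr (r e : R) : 0 <= r -> r < 1 -> 0 < e ->
  exists N, forall k, (N <= k)%N -> r ^+ k < e.
Proof.
move=> r0 r1 e0; have := @cvg_expr R r; rewrite ger0_norm// => /(_ r1).
move=> /cvgr0Pnorm_lt/(_ e e0)[N _ hN]; exists N => k Nk.
by have := hN k Nk; rewrite ger0_norm// exprn_ge0.
Qed.

Lemma neumann_left_inverse_lt1 x : A x -> nrm x < 1 ->
  exists2 s, A s & mul s (one - x) = one.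
Proof.
move=> Ax x1; have x0 := ban_norm_ge0 Ax; have A1 := alg_one AA.
have A1x : A (one - x) by exact: alg_sub.
have S N := alg_psum N Ax; have P N := alg_pow N Ax.
have dist N k : nrm (psum x (N + k) - psum x N) * (1 - nrm x) <=
    nrm x ^+ N - nrm x ^+ (N + k).
  elim: k => [|k ih]; first by rewrite addn0 !subrr ban_norm0 mul0r.
  rewrite addnS big_ord_recr/= addrAC.
  have h1 := ban_normD BA (alg_sub (S (N + k)%N) (S N)) (P (N + k)%N).
  have h2 := le_trans h1 (lerD (lexx _) (ban_norm_pow (N + k) Ax)).
  have r1 : 0 <= 1 - nrm x by rewrite subr_ge0 ltW.
  apply: (le_trans (ler_wpM2r r1 h2)); rewrite exprS.
  by move: ih; set d := nrm (_ - _); set t := _ ^+ (N + k); lra.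
have dist2 N k : (N <= k)%N ->
    nrm (psum x k - psum x N) <= nrm x ^+ N / (1 - nrm x).
  move=> Nk; rewrite ler_pdivlMr ?subr_gt0//.
  have := dist N (k - N)%N; rewrite subnKC// => /le_trans -> //.
  by rewrite gerBl exprn_ge0.
have [t At tlim] : exists2 l, A l &
    nrm (psum x k - l) @[k --> \oo] --> (0 : R).
  apply: (ban_complete BA) => // e e0.
  have d0 : 0 < 1 - nrm x by rewrite subr_gt0.
  have e20 : 0 < e / 2 * (1 - nrm x) by rewrite !mulr_gt0.
  have [N hN] := small_expr x0 x1 e20; exists N => p q Np Nq.
  rewrite (_ : _ - _ = (psum x p - psum x N) + (psum x N - psum x q)); last first.
    by rewrite addrA subrK.
  apply: (le_lt_trans (ban_normD BA (alg_sub (S p) (S N)) (alg_sub (S N) (S q)))).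
  rewrite (ban_normB (S N) (S q)).
  have := dist2 _ _ Np; have := dist2 _ _ Nq.
  have : nrm x ^+ N / (1 - nrm x) < e / 2 by rewrite ltr_pdivrMr// hN.
  lra.
exists t => //; apply/eqP; rewrite -subr_eq0; apply/eqP.
have Atx : A (mul t (one - x)) by exact: (alg_mul AA).
apply: (ban_norm_eq0 BA); first exact: alg_sub.
apply/eqP; rewrite eq_le ban_norm_ge0 ?andbT; last exact: alg_sub.
apply/ler_addgt0Pl => e e0; rewrite addr0.
have bound k : nrm (mul t (one - x) - one) <=
    nrm (psum x k - t) * nrm (one - x) + nrm x ^+ k.
  have Ad := alg_sub At (S k).
  have A0p := alg_sub alg_0 (P k).
  have Adx := alg_mul AA Ad A1x.
  rewrite (_ : _ - _ = mul (t - psum x k) (one - x) + (0 - pw x k)); last first.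
    by rewrite alg_mulBl// alg_geometric// sub0r opprB -addrA addrAC subrr add0r.
  apply: (le_trans (ban_normD BA Adx A0p)); apply: lerD.
    by rewrite [X in _ <= X * _]ban_normB// (ban_normM BA).
  by rewrite (ban_normB alg_0 (P k)) subr0 ban_norm_pow.
have c0 := ban_norm_ge0 A1x.
have d0 : 0 < e / 2 / (nrm (one - x) + 1) by rewrite !divr_gt0// ltr_wpDl.
move/cvgr0Pnorm_lt : tlim => /(_ _ d0)[N1 _ h1].
have [N2 h2] := small_expr x0 x1 (divr_gt0 e0 (ltr0Sn _ 1)).
pose k := maxn N1 N2; have Sk := alg_sub (S k) At.
have hk : nrm (psum x k - t) * (nrm (one - x) + 1) < e / 2.
  have := h1 k (leq_maxl N1 N2); rewrite /= ger0_norm ?ban_norm_ge0//.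
  by rewrite ltr_pdivlMr// ltr_wpDl.
have := bound k; have := h2 k (leq_maxr N1 N2); have := ban_norm_ge0 Sk; lra.
Qed.

(** It is enough that some power of h be small, because 1 - h divides 1 - h^m. *)
Lemma neumann_left_inverse h m : A h -> nrm (pw h m) < 1 ->
  exists2 s, A s & mul s (one - h) = one.
Proof.
move=> Ah hm; have Am := alg_pow m Ah.
have [t At t1] := neumann_left_inverse_lt1 Am hm.
have A1 := alg_one AA; have S := alg_psum m Ah.
exists (mul t (psum h m)); first exact: (alg_mul AA).
by rewrite -(alg_mulA AA) ?alg_geometric//; exact: alg_sub.
Qed.

End Neumann.

(** * A growth estimate for iterated squares *)

Section Brandenburg.
Variable R : realType.

(** In terms of u_k = F k / rho^(2^k), and with t the power of u_k that makes the
    two terms equal, the hypothesis reads u_(k+1) <= 2 (1 + C) u_k^(2 - g).  If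
    every F k were at least one, then ln u_k >= 2^k |ln rho|, and the exponent
    2 - g < 2 would make ln u_k / 2^k decrease by a fixed amount at each step. *)
Lemma brandenburg_small (F : nat -> R) (rho C : R) (q : nat) :
  0 < rho < 1 -> 0 <= C ->
  (forall k t, 1 <= t ->
     F k.+1 <= 2 * F k * (F k / t + C * t ^+ q * rho ^+ (2 ^ k))) ->
  exists k, F k < 1.
Proof.
move=> /andP[rho0 rho1] C0 Fstep; apply: contrapT => /forallNP FN.
have F1 k : 1 <= F k by rewrite leNgt; exact/negP/FN.
pose s k := rho ^+ (2 ^ k); have s0 k : 0 < s k by rewrite exprn_gt0.
have sS k : s k.+1 = s k * s k by rewrite /s expnS mulnC exprM expr2.
pose u k := F k / s k.
have F0 k : 0 < F k := lt_le_trans ltr01 (F1 k).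
have u0 k : 0 < u k by rewrite divr_gt0.
pose L k := ln (u k); pose l := - ln rho.
have l0 : 0 < l by rewrite oppr_gt0 ln_lt0// rho0.
have Ll k : 2 ^+ k * l <= L k.
  have -> : 2 ^+ k * l = ln (s k)^-1.
    have e : ln (s k) = 2 ^+ k * ln rho by rewrite lnXn// -natrX mulr_natl.
    by rewrite lnV ?posrE// e mulrN.
  by rewrite ler_ln ?posrE ?invr_gt0// ler_peMl// invr_ge0 ltW.
have L0 k : 0 < L k by rewrite (lt_le_trans _ (Ll k))// mulr_gt0// exprn_gt0.
pose g : R := (q.+1%:R)^-1; have g0 : 0 < g by rewrite invr_gt0.
pose D := ln (2 * (1 + C)).
have C2 : 0 < 2 * (1 + C) by rewrite mulr_gt0// ltr_wpDr.
have D0 : 0 <= D by rewrite ln_ge0//; lra.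
have LS k : L k.+1 <= D + L k * (2 - g).
  (* t is the power u_k^g, with g (q + 1) = 1, so that u_k / t = t^q *)
  pose t := expR (L k * g).
  have t1 : 1 <= t by rewrite -expR0 ler_expR ltW// mulr_gt0.
  have t0 : 0 < t by rewrite expR_gt0.
  have ut : u k = t ^+ q * t.
    rewrite -exprSr -expRM_natr -mulrA mulVf ?mulr1 ?pnatr_eq0//.
    by rewrite lnK// posrE.
  have uS : u k.+1 <= 2 * (1 + C) * (u k * t ^+ q).
    rewrite /u ler_pdivrMr// sS (le_trans (Fstep k t t1))// -/(s k).
    have -> : F k = u k * s k by rewrite divfK// gt_eqF.
    have -> : u k * s k / t = t ^+ q * s k.
      by rewrite {1}ut; field; rewrite gt_eqF.
    rewrite le_eqVlt; apply/orP; left; apply/eqP.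
    by rewrite mulfK ?gt_eqF//; ring.
  have gq : g * (q%:R + 1) = 1 by rewrite natr1 mulVf ?pnatr_eq0.
  have -> : 2 - g = 1 + g * q%:R by lra.
  rewrite mulrDr mulr1 mulrA -ler_expR !expRD expRM_natr -/t !lnK ?posrE//.
pose d := l * g / 2; have d0 : 0 < d by rewrite divr_gt0// mulr_gt0.
have key k : L k + D <= 2 ^+ k * (L 0%N + D - k%:R * d).
  elim: k => [|k ih]; first by rewrite mul1r mul0r subr0.
  have h1 := LS k; have h2 : 2 ^+ k * l * g <= L k * g by rewrite ler_pM2r.
  rewrite exprS -[k.+1%:R]natr1.
  have -> : 2 * 2 ^+ k * (L 0%N + D - (k%:R + 1) * d) =
    2 * (2 ^+ k * (L 0%N + D - k%:R * d)) - 2 ^+ k * l * g.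
    by rewrite /d; field.
  lra.
have [k hk] : exists k : nat, (L 0%N + D) / d <= k%:R.
  exists (Num.bound ((L 0%N + D) / d)); rewrite ltW// archi_boundP//.
  by rewrite divr_ge0 ?ltW// ltr_pwDl.
have := key k; have : 2 ^+ k * (L 0%N + D - k%:R * d) <= 0.
  by rewrite mulr_ge0_le0 ?exprn_ge0// subr_le0 -ler_pdivrMr.
have := L0 k; lra.
Qed.

End Brandenburg.

(** * Summability over the lattice *)

Section LatticeSums.
Variable R : realType.

Lemma nsum_inj_le (T U : choiceType) (e : T -> U) (f : U -> R) :
  injective e -> (forall u, 0 <= f u) -> nfin f ->
  (nsum (fun t => f (e t)) <= nsum f)%E.
Proof.
move=> inje f0 ff; rewrite -(fine_nsumK f0 ff); apply: nsum_le_seq => s us.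
rewrite -(big_map e xpredT f) -lee_fin fine_nsumK//.
by apply: seq_le_nsum => //; rewrite map_inj_uniq.
Qed.

Lemma nsum_pair (T U : choiceType) (f : T -> R) (g : U -> R) :
  (forall t, 0 <= f t) -> (forall u, 0 <= g u) -> nfin f -> nfin g ->
  (nsum (fun p : T * U => (f p.1 * g p.2)%R) < +oo)%E.
Proof.
move=> f0 g0 ff gf.
have := nsum_nsumM f0 g0 gf; rewrite /nsum esum_esum; last first.
  by move=> *; rewrite lee_fin mulr_ge0.
rewrite (_ : _ `*`` _ = setT); last by apply/seteqP; split.
move=> ->; rewrite -/(nsum f) -/(nsum g) -(fine_nsumK f0 ff).
by rewrite -(fine_nsumK g0 gf) -EFinM ltry.
Qed.

(** Telescoping: the k-th term is at most 2/(1+k) - 2/(2+k). *)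
Lemma nfin_inv_sqr_nat : (nsum (fun k : nat => ((1 + k%:R) ^- 2 : R)%R) < +oo)%E.
Proof.
have p0 k : 0 <= (1 + k%:R) ^- 2 :> R by rewrite invr_ge0 exprn_ge0// addr_ge0.
apply: (@le_lt_trans _ _ 2%:E); last exact: ltry.
rewrite /nsum -nneseries_esumT; last by move=> k; rewrite lee_fin.
apply: lime_le; first by apply: is_cvg_nneseries => k _ _; rewrite lee_fin.
apply: nearW => M; rewrite sumEFin lee_fin.
apply: (@le_trans _ _ (2 - 2 / (1 + M%:R))); last by rewrite gerBl divr_ge0 ?addr_ge0.
elim: M => [|M ih]; first by rewrite big_geq// addr0 divr1 subrr.
rewrite big_nat_recr//= (le_trans (lerD ih (lexx _)))//.
have M0 : 0 <= M%:R :> R by [].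
rewrite -natr1 -subr_ge0.
rewrite (_ : _ - _ = (M%:R) / ((1 + M%:R) ^+ 2 * (2 + M%:R))); last first.
  by field; rewrite !gt_eqF//; lra.
by rewrite divr_ge0// mulr_ge0 ?sqr_ge0// addr_ge0.
Qed.

Lemma nfin_inv_sqr_int :
  (nsum (fun j : int => ((1 + `|j%:~R|) ^- 2 : R)%R) < +oo)%E.
Proof.
pose f (p : bool * nat) : R := 1 * (1 + p.2%:R) ^- 2.
have p0 k : 0 <= (1 + k%:R) ^- 2 :> R by rewrite invr_ge0 exprn_ge0// addr_ge0.
have f0 p : 0 <= f p by rewrite /f mul1r.
have ff : nfin f.
  apply: (@nsum_pair bool nat (fun=> 1) (fun k => (1 + k%:R) ^- 2)) => //;
    last exact: nfin_inv_sqr_nat.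
  apply: (@le_lt_trans _ _ 2%:E); last exact: ltry.
  apply: nsum_le_seq => s us; rewrite big_const_seq count_predT iter_addr_0.
  by rewrite ler_nat -(card_uniqP us) -card_bool max_card.
have inj : injective (fun j : int => (j < 0, absz j)).
  by move=> [j|j] [k|k] //= [] ->.
apply: (le_lt_trans _ ff).
apply: le_trans (nsum_inj_le inj f0 ff); apply: le_nsum => j.
by rewrite /f mul1r /= -intr_norm -abszE -pmulrn.
Qed.

(** Tonelli, one coordinate at a time. *)
Lemma nfin_inv_sqr_lattice n :
  (nsum (fun x : 'rV[int]_n => (\prod_(i < n) (1 + `|(x ord0 i)%:~R|) ^- 2 : R)%R)
     < +oo)%E.
Proof.
have p0 (j : int) : 0 <= (1 + `|j%:~R|) ^- 2 :> R.
  by rewrite invr_ge0 exprn_ge0// addr_ge0.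
elim: n => [|n ih].
  rewrite (@nsum_fin_supp1 _ _ _ 0) ?ltry//; first by rewrite big_ord0.
  by move=> x; rewrite [x]thinmx0 eqxx.
pose f (p : int * 'rV[int]_n) : R :=
  (1 + `|p.1%:~R|) ^- 2 * \prod_(i < n) (1 + `|(p.2 ord0 i)%:~R|) ^- 2.
have pp0 (x : 'rV[int]_n) : 0 <= \prod_(i < n) (1 + `|(x ord0 i)%:~R|) ^- 2 :> R.
  by apply: prodr_ge0.
have f0 p : 0 <= f p by rewrite mulr_ge0.
have ff : nfin f.
  apply: (@nsum_pair int 'rV[int]_n (fun j => (1 + `|j%:~R|) ^- 2)
    (fun x => \prod_(i < n) (1 + `|(x ord0 i)%:~R|) ^- 2)) => //.
  exact: nfin_inv_sqr_int.
pose e (x : 'rV[int]_n.+1) := (x ord0 ord0, \row_i x ord0 (lift ord0 i)).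
have inj : injective e.
  move=> x y [e0 /rowP e1]; apply/rowP => i.
  case: (unliftP ord0 i) => [j ->|->//].
  by have := e1 j; rewrite !mxE.
apply: (le_lt_trans _ ff).
apply: le_trans (nsum_inj_le inj f0 ff); apply: le_nsum => x.
rewrite big_ord_recl /f /=; under [X in _ <= _ * X]eq_bigr do rewrite mxE.
by [].
Qed.

End LatticeSums.

(** * Norms on R^n *)

Section Norms.
Variables (R : realType) (n : nat) (N : 'rV[R]_n -> R).
Hypothesis N_norm : is_norm N.

Lemma norm_D x y : N (x + y) <= N x + N y. Proof. by case: N_norm. Qed.
Lemma norm_Z (c : R) x : N (c *: x) = `|c| * N x. Proof. by case: N_norm. Qed.
Lemma norm_0 : N 0 = 0.
Proof. by rewrite -(scale0r (0 : 'rV[R]_n)) norm_Z normr0 mul0r. Qed.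
Lemma norm_N x : N (- x) = N x.
Proof. by rewrite -scaleN1r norm_Z normrN1 mul1r. Qed.
Lemma norm_ge0 x : 0 <= N x.
Proof. have := norm_D x (- x); rewrite subrr norm_0 norm_N; lra. Qed.

Lemma coord_le_mx_norm (x : 'rV[R]_n) i : `|x ord0 i| <= `|x|.
Proof.
have /mapP[j Hj ->] : `|x ord0 i| \in [seq `|x y.1 y.2| | y : 'I_1 * 'I_n].
  by apply/mapP; exists (ord0, i) => //=; rewrite mem_enum.
by rewrite [leRHS]/Num.norm /= mx_normrE; apply/bigmax_geP; right => /=; exists j.
Qed.

Lemma norm_le_mx_norm : exists2 M : R, 0 <= M & forall x, N x <= M * `|x|.
Proof.
exists (\sum_(i < n) N (delta_mx ord0 i)).
  by apply: sumr_ge0 => i _; exact: norm_ge0.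
move=> x; rewrite {1}(row_sum_delta x) mulr_suml.
elim/big_ind2: _ => [|y p z q yp zq|i _]; first by rewrite norm_0.
  exact: le_trans (norm_D _ _) (lerD yp zq).
by rewrite norm_Z mulrC ler_wpM2l ?norm_ge0// coord_le_mx_norm.
Qed.

(** The norm attains a positive minimum on the compact unit sphere of the
    maximum norm. *)
Lemma coord_le_norm : exists2 K : R, 1 <= K &
  forall (x : 'rV[R]_n) i, `|x ord0 i| <= K * N x.
Proof.
have [M M0 NM] := norm_le_mx_norm.
have [i0|n0] := pselect (exists i : 'I_n, True); last first.
  by exists 1 => // x i; exfalso; apply: n0; exists i.
pose S := [set x : 'rV[R]_n | `|x| = 1].
have cN : continuous N.
  move=> x; apply/(@cvgrPdist_le _ _ _ _ (nbhs_filter x)) => e e0.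
  have FF := nbhs_filter x; near=> y.
  have le1 : N x - N y <= N (x - y).
    by have := norm_D (x - y) y; rewrite subrK; lra.
  have le2 : N y - N x <= N (x - y).
    by have := norm_D (y - x) x; rewrite subrK -(norm_N (y - x)) opprB; lra.
  apply: (@le_trans _ _ (M * `|x - y|)).
    by rewrite (le_trans _ (NM _))// ler_norml; lra.
  apply: (@le_trans _ _ ((M + 1) * `|x - y|)); first by rewrite ler_wpM2r// lerDl.
  rewrite mulrC -ler_pdivlMr ?ltr_wpDl//; near: y.
  by apply: cvgr_dist_le; [exact: cvg_id|rewrite divr_gt0// ltr_wpDl].
have cS : compact S.
  apply: bounded_closed_compact.
    exists 1; split; first exact: num_real.
    by move=> r r1 x /= ->; exact: ltW.
  rewrite (_ : S = (fun x : 'rV[R]_n => `|x|) @^-1` [set 1]) //.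
  apply: closed_comp; last exact: closed_eq.
  by move=> x _; exact: norm_continuous.
have [i _] := i0; have S0 : S !=set0.
  exists (delta_mx ord0 i); rewrite /S/=; apply/eqP; rewrite eq_le.
  apply/andP; split; last first.
    have := coord_le_mx_norm (delta_mx ord0 i) i.
    by rewrite mxE !eqxx normr1.
  rewrite [leLHS]/Num.norm/= mx_normrE; apply/bigmax_leP; split => // -[p q] _ /=.
  by rewrite mxE; case: (_ && _); rewrite ?normr1 ?normr0.
have [c /set_mem cS1 cmin] := compact_EVT_min S0 cS (continuous_subspaceT cN).
have Nc : 0 < N c.
  rewrite lt_neqAle norm_ge0 andbT eq_sym; apply/eqP => Nc0.
  have [h _ _] := N_norm; have c0 := h _ Nc0.
  by move: cS1; rewrite /S/= c0 normr0 => /eqP; rewrite eq_sym oner_eq0.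
exists (Num.max 1 (N c)^-1); first by rewrite le_max lexx.
move=> x j; apply: (le_trans (coord_le_mx_norm x j)).
have [->|x0] := eqVneq x 0; first by rewrite normr0 norm_0 mulr0.
have nx : 0 < `|x| by rewrite normr_gt0.
apply: (@le_trans _ _ ((N c)^-1 * N x)); last first.
  by rewrite ler_wpM2r ?norm_ge0// le_max lexx orbT.
rewrite mulrC ler_pdivlMr// -ler_pdivlMl//.
have := cmin (`|x|^-1 *: x); rewrite norm_Z ger0_norm ?invr_ge0//; apply.
apply/mem_set; rewrite /S/= normrZ ger0_norm ?invr_ge0// mulVf// gt_eqF//.
Unshelve. all: by end_near. Qed.

End Norms.

(** * Polynomial and subexponential weights *)

Section Weights.
Variable R : realType.

(** Bernoulli's inequality, as Young's inequality for the conjugate exponents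
    1/b and 1/(1-b). *)
Lemma powR1D_le (b t : R) : 0 < b -> b < 1 -> 0 <= t ->
  (1 + t) `^ b <= 1 + b * t.
Proof.
move=> b0 b1 t0.
have b1' : 0 < 1 - b by rewrite subr_gt0.
have := @conjugate_powR R ((1 + t) `^ b) 1 b^-1 (1 - b)^-1.
rewrite !invrK powR1 mulr1 -powRrM mulfV ?gt_eqF// powRr1 ?addr_ge0//.
rewrite powR_ge0 ler01 !invr_gt0 b0 b1' addrC subrK => /(_ isT isT isT isT erefl).
by move=> /le_trans; apply; rewrite le_eqVlt; apply/orP; left; apply/eqP; ring.
Qed.

(** Concavity of t^b, in the form where the smaller of the two summands carries
    the factor b. *)
Lemma powRD_le (b r s : R) : 0 < b -> b < 1 -> 0 <= s -> s <= r ->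
  (r + s) `^ b <= r `^ b + b * s `^ b.
Proof.
move=> b0 b1 s0 sr; have [r0|r0] := eqVneq r 0.
  have -> : s = 0 by apply/eqP; rewrite eq_le s0 andbT -r0.
  by rewrite addr0 lerDl mulr_ge0 ?powR_ge0// ltW.
have rp : 0 < r by rewrite lt_neqAle eq_sym r0 (le_trans s0).
have t0 : 0 <= s / r by rewrite divr_ge0// ltW.
have -> : r + s = r * (1 + s / r) by field.
rewrite powRM ?addr_ge0// ?(ltW rp)//.
apply: (le_trans (ler_wpM2l (powR_ge0 _ _) (powR1D_le b0 b1 t0))).
rewrite mulrDr mulr1 lerD2l mulrCA ler_wpM2l ?(ltW b0)//.
have {2}-> : s = r * (s / r) by field.
rewrite powRM ?(ltW rp)// ler_wpM2l ?powR_ge0//.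
have [->|sr0] := eqVneq (s / r) 0; first exact: powR_ge0.
rewrite ger1_powR ?(ltW b1)// lt_neqAle eq_sym sr0 t0/=.
by rewrite ler_pdivrMr// mul1r.
Qed.

Lemma powRD_le_add (b r s : R) : 0 < b -> b < 1 -> 0 <= r -> 0 <= s ->
  (r + s) `^ b <= r `^ b + s `^ b.
Proof.
move=> b0 b1 r0 s0; wlog sr : r s r0 s0 / s <= r => [h|].
  have [|/ltW] := leP s r; first exact: h.
  by move=> rs; rewrite addrC [leRHS]addrC; exact: h.
apply: (le_trans (powRD_le b0 b1 s0 sr)); rewrite lerD2l.
by rewrite ler_piMl ?powR_ge0 ?(ltW b1).
Qed.

(** With r = t^b one has (1 + t)^s <= (1 + r)^(s/b), and a fixed power of 1 + r
    is at most a multiple of exp(a r). *)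
Lemma powR1D_le_exp (a b s : R) : 0 < a -> 0 < b -> b < 1 -> 0 <= s ->
  exists2 D, 0 <= D & forall t, 0 <= t -> (1 + t) `^ s <= D * expR (a * t `^ b).
Proof.
move=> a0 b0 b1 s0.
pose m := (Num.bound (s / b)).+1; pose c := a / m%:R.
have c0 : 0 < c by rewrite divr_gt0.
have c1 : 0 <= 1 + c^-1 by rewrite addr_ge0// invr_ge0 ltW.
exists ((1 + c^-1) ^+ m); first exact: exprn_ge0.
move=> t t0; set r := t `^ b; have r0 : 0 <= r by exact: powR_ge0.
have -> : s = b * (s / b) by field; rewrite gt_eqF.
rewrite powRrM; have h1 : (1 + t) `^ b <= 1 + r.
  by have := powRD_le_add b0 b1 ler01 t0; rewrite powR1.
have sb0 : 0 <= s / b by rewrite divr_ge0// ltW.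
apply: (@le_trans _ _ ((1 + r) `^ (s / b))).
  by apply: ge0_ler_powR => //; rewrite nnegrE ?powR_ge0// addr_ge0.
apply: (@le_trans _ _ ((1 + r) `^ m%:R)).
  apply: ler_powR; first by rewrite lerDl.
  by rewrite -natr1 ltW// ltr_wpDr// archi_boundP.
rewrite powR_mulrn ?addr_ge0//.
have -> : a * r = m%:R * (c * r) by rewrite /c; field; rewrite pnatr_eq0.
rewrite expRM_natl -exprMn lerXn2r ?nnegrE ?addr_ge0//.
  by rewrite mulr_ge0// expR_ge0.
apply: (@le_trans _ _ ((1 + c^-1) * (1 + c * r))); last first.
  by rewrite ler_wpM2l// expR_ge1Dx.
have -> : (1 + c^-1) * (1 + c * r) = 1 + r + (c^-1 + c * r).
  by field; rewrite gt_eqF.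
by rewrite lerDl addr_ge0 ?invr_ge0 ?(ltW c0)// mulr_ge0// ltW.
Qed.

Variables (n : nat) (N : 'rV[R]_n -> R).
Hypothesis N_norm : is_norm N.
Local Notation Zn := 'rV[int]_n.
Implicit Types x y : Zn.

Lemma latnorm_ge0 x : 0 <= latnorm N x. Proof. exact: norm_ge0. Qed.

Lemma latnormD x y : latnorm N (x + y) <= latnorm N x + latnorm N y.
Proof. by rewrite /latnorm map_mxD norm_D. Qed.

Lemma latnormN x : latnorm N (- x) = latnorm N x.
Proof. by rewrite /latnorm map_mxN norm_N. Qed.

Lemma latnorm0 : latnorm N (0 : Zn) = 0.
Proof. by rewrite /latnorm map_mx0 norm_0. Qed.

Lemma poly_weight_ge1 s x : 0 <= s -> 1 <= poly_weight N s x.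
Proof.
move=> s0; rewrite -[leLHS](powRr0 (1 + latnorm N x)).
by apply: ler_powR => //; rewrite lerDl latnorm_ge0.
Qed.

Lemma poly_weightM s x y : 0 <= s ->
  poly_weight N s (x + y) <= poly_weight N s x * poly_weight N s y.
Proof.
move=> s0; have X := latnorm_ge0 x; have Y := latnorm_ge0 y.
rewrite /poly_weight -powRM ?addr_ge0//; apply: ge0_ler_powR => //.
- by rewrite nnegrE addr_ge0// latnorm_ge0.
- by rewrite nnegrE mulr_ge0// addr_ge0.
- have := latnormD x y; nra.
Qed.

Section Subexponential.
Variables a b : R.
Hypotheses (a_gt0 : 0 < a) (b_gt0 : 0 < b) (b_lt1 : b < 1).
Local Notation v := (subexp_weight N a b).

(** The power v^b of the weight v, in a form ready for comparison of exponents. *)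
Definition subexp_weight_pow x : R := expR (b * (a * latnorm N x `^ b)).
Local Notation vb := subexp_weight_pow.

Lemma subexp_weight_ge1 x : 1 <= v x.
Proof.
by rewrite -expR0 ler_expR mulr_ge0 ?powR_ge0// ltW.
Qed.

Lemma subexp_weight_pow_ge0 x : 0 <= vb x. Proof. exact: expR_ge0. Qed.

Lemma subexp_weight0 : v 0 = 1.
Proof.
by rewrite /subexp_weight latnorm0 powR0 ?mulr0 ?expR0// gt_eqF.
Qed.

Lemma subexp_weightN x : v (- x) = v x.
Proof. by rewrite /subexp_weight latnormN. Qed.

Lemma subexp_weightM x y : v (x + y) <= v x * v y.
Proof.
rewrite -expRD ler_expR -mulrDr ler_wpM2l ?(ltW a_gt0)//.
have X := latnorm_ge0 x; have Y := latnorm_ge0 y.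
apply: le_trans (powRD_le_add b_gt0 b_lt1 X Y).
apply: ge0_ler_powR; rewrite ?nnegrE ?(ltW b_gt0) ?addr_ge0 ?latnorm_ge0//.
exact: latnormD.
Qed.

(** The smaller of |x| and |y| enters |x + y|^b with the factor b, hence
    contributes only the power v^b of the weight. *)
Lemma subexp_weightD x y : v (x + y) <= v x * vb y + vb x * v y.
Proof.
have X := latnorm_ge0 x; have Y := latnorm_ge0 y.
have P z := expR_ge0 z.
have le1 : latnorm N (x + y) `^ b <= (latnorm N x + latnorm N y) `^ b.
  apply: ge0_ler_powR; rewrite ?nnegrE ?(ltW b_gt0) ?addr_ge0 ?latnorm_ge0//.
  exact: latnormD.
have [h|/ltW h] := leP (latnorm N y) (latnorm N x).
  apply: (@le_trans _ _ (v x * vb y)); last by rewrite lerDl mulr_ge0 ?P.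
  rewrite -expRD ler_expR mulrCA -mulrDr ler_wpM2l ?(ltW a_gt0)//.
  exact: le_trans le1 (powRD_le b_gt0 b_lt1 Y h).
apply: (@le_trans _ _ (vb x * v y)); last by rewrite lerDr mulr_ge0 ?P.
rewrite -expRD ler_expR mulrCA -mulrDr ler_wpM2l ?(ltW a_gt0)//.
apply: (le_trans le1); rewrite [latnorm N x + _]addrC [leRHS]addrC.
exact: powRD_le.
Qed.

(** Where v^(1-b) is at least t the first term dominates v^b; elsewhere v^(b+1)
    is at most a fixed power of t. *)
Lemma subexp_weight_pow_le : exists q : nat, forall t x, 1 <= t ->
  vb x <= v x / t + t ^+ q * (v x)^-1.
Proof.
have b1 : 0 < 1 - b by rewrite subr_gt0.
pose q := Num.bound ((1 + b) / (1 - b)); exists q => t x t1.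
have t0 : 0 < t := lt_le_trans ltr01 t1.
have v0 : 0 < v x by rewrite expR_gt0.
rewrite /subexp_weight_pow; set A := a * _.
have A0 : 0 <= A by rewrite mulr_ge0 ?powR_ge0// ltW.
have [h|/ltW h] := leP t (expR ((1 - b) * A)).
  apply: (@le_trans _ _ (v x / t)); last first.
    by rewrite lerDl mulr_ge0 ?exprn_ge0 ?invr_ge0// ltW.
  rewrite ler_pdivlMr// (le_trans (ler_wpM2l (expR_ge0 _) h))//.
  by rewrite -expRD -mulrDl addrC subrK mul1r.
apply: (@le_trans _ _ (t ^+ q * (v x)^-1)); last first.
  by rewrite lerDr divr_ge0 ?ltW.
rewrite ler_pdivlMr// -expRD.
apply: (@le_trans _ _ (expR ((1 - b) * A) ^+ q)); last first.
  by rewrite lerXn2r ?nnegrE ?expR_ge0// ltW.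
rewrite -expRM_natr ler_expR.
have -> : b * A + a * latnorm N x `^ b = (1 + b) * A by rewrite /A; ring.
rewrite mulrAC ler_wpM2r// mulrC -ler_pdivrMr// ltW// archi_boundP//.
by rewrite divr_ge0 ?ltW// addr_gt0.
Qed.

(** By the comparison of norms, 1/v is dominated by the inverse of
    a product of powers of the 1 + |x_i|, which is summable. *)
Lemma nfin_subexp_weight : (nsum (fun x => ((v x) ^- 2)%R) < +oo)%E.
Proof.
have [D D0 hD] := powR1D_le_exp a_gt0 b_gt0 b_lt1 (ler0n R (n * 2)).
have [K K1 hK] := coord_le_norm N_norm.
have K0 : 0 <= K := le_trans ler01 K1.
pose p x : R := \prod_(i < n) (1 + `|(x ord0 i)%:~R|) ^- 2.
have p0 x : 0 <= p x.
  by apply: prodr_ge0 => i _; rewrite invr_ge0 exprn_ge0// addr_ge0.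
apply: (@nsum_fin_le _ _ _ (fun x => D * K ^+ (n * 2) * p x)); last first.
  rewrite nsumZ//; last by rewrite mulr_ge0// exprn_ge0.
  by rewrite lte_mul_pinfty ?nfin_inv_sqr_lattice// lee_fin mulr_ge0// exprn_ge0.
move=> x; have v1 := subexp_weight_ge1 x.
have v0 : 0 < v x := lt_le_trans ltr01 v1.
apply: (@le_trans _ _ (v x)^-1).
  by rewrite lef_pV2 ?posrE ?exprn_gt0// expr2 ler_peMl// ltW.
have L0 := latnorm_ge0 x.
have := hD _ L0; rewrite powR_mulrn ?addr_ge0// -/(v x) => h.
have pE : p x = (\prod_(i < n) (1 + `|(x ord0 i)%:~R|)) ^- 2.
  by rewrite -prodrXl -prodfV.
have q0 : 0 < \prod_(i < n) (1 + `|(x ord0 i)%:~R|) :> R.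
  by apply: prodr_gt0 => i _; rewrite ltr_pwDl.
have hq : \prod_(i < n) (1 + `|(x ord0 i)%:~R|) <= K ^+ n * (1 + latnorm N x) ^+ n.
  rewrite -exprMn -[X in _ <= _ ^+ X]card_ord -prodr_const.
  apply: ler_prod => i _; rewrite addr_ge0//= mulrDr mulr1 lerD//.
  by have := hK (map_mx intr x) i; rewrite mxE.
rewrite pE -[leLHS]mul1r ler_pdivrMr// mulrAC ler_pdivlMr ?exprn_gt0// mul1r.
apply: (@le_trans _ _ (K ^+ (n * 2) * (1 + latnorm N x) ^+ (n * 2))).
  rewrite -exprMn exprM lerXn2r ?nnegrE ?exprMn ?mulr_ge0 ?exprn_ge0 ?addr_ge0//.
  exact: ltW.
rewrite [D * _]mulrC -mulrA ler_wpM2l ?exprn_ge0//.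
Qed.

End Subexponential.

End Weights.

(** * The Hilbert space l^2 and the regular representation *)

Section Ell2Theory.
Variables (R : realType) (n : nat).
Local Notation C := R[i].
Local Notation Zn := 'rV[int]_n.
Local Notation l2 := (ell2 R n).
Implicit Types (g u w : l2) (x y : Zn).

Lemma ell2_fin g : (nsum (fun x => (cmod (g x) ^+ 2)%R) < +oo)%E.
Proof. by case: g. Qed.

Lemma ell2_norm_ge0 g : 0 <= ell2_norm g. Proof. exact: sqrtr_ge0. Qed.

Lemma ell2_norm_sqrE g :
  (ell2_norm g ^+ 2)%:E = nsum (fun x => cmod (g x) ^+ 2).
Proof.
have p0 x : 0 <= cmod (g x) ^+ 2 by exact: sqr_ge0.
by rewrite sqr_sqrtr ?fine_nsum_ge0// fine_nsumK//; exact: ell2_fin.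
Qed.

Lemma ell2_norm_sqr g :
  ell2_norm g ^+ 2 = rsum (fun x => cmod (g x) ^+ 2).
Proof.
have p0 x : 0 <= cmod (g x) ^+ 2 by exact: sqr_ge0.
rewrite rsum_ge0E//; last exact: ell2_fin.
by apply/EFin_inj; rewrite ell2_norm_sqrE fine_nsumK//; exact: ell2_fin.
Qed.

Lemma cmod_le_ell2_norm g x : cmod (g x) <= ell2_norm g.
Proof.
rewrite -(@ler_pXn2r _ 2)// ?nnegrE ?cmod_ge0 ?ell2_norm_ge0//.
rewrite -lee_fin ell2_norm_sqrE.
by apply: (nsum_ub (f := fun x => cmod (g x) ^+ 2)) => y; exact: sqr_ge0.
Qed.

Lemma ell2_cbounded g : cbounded g.
Proof. by exists (ell2_norm g) => x; exact: cmod_le_ell2_norm. Qed.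

Lemma ell2_ext g u : (g : Zn -> C) = u -> g = u.
Proof. exact: val_inj. Qed.

Lemma ell2_norm_eq0 g : ell2_norm g = 0 -> g = 0.
Proof.
move=> g0; apply: ell2_ext; apply/funext => x.
have := cmod_le_ell2_norm g x; rewrite g0 => h.
by apply: ComplexField.Normc.eq0_normc; apply/eqP; rewrite eq_le h cmod_ge0.
Qed.

Lemma ell2_normZ (c : C) g : ell2_norm (c *: g) = cmod c * ell2_norm g.
Proof.
have sq x : 0 <= cmod (g x) ^+ 2 by exact: sqr_ge0.
have e : ell2_norm (c *: g) ^+ 2 = (cmod c * ell2_norm g) ^+ 2.
  apply/EFin_inj; rewrite [in RHS]exprMn [RHS]EFinM !ell2_norm_sqrE.
  rewrite -nsumZ ?sqr_ge0//; apply: eq_nsum => x.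
  by rewrite -[(c *: g) x]/(c * g x) cmodM exprMn.
by apply: (pexpIrn (n := 2)) e; rewrite // nnegrE ?mulr_ge0 ?cmod_ge0 ?ell2_norm_ge0.
Qed.

Lemma ell2_norm0 : ell2_norm (0 : l2) = 0.
Proof. by rewrite -(scale0r (0 : l2)) ell2_normZ cmod0 mul0r. Qed.

Lemma ell2_norm_le g M : 0 <= M ->
  (nsum (fun x => (cmod (g x) ^+ 2)%R) <= (M ^+ 2)%:E)%E -> ell2_norm g <= M.
Proof.
move=> M0; rewrite -ell2_norm_sqrE lee_fin ler_pXn2r// nnegrE ell2_norm_ge0//.
Qed.

(** Cauchy-Schwarz from its family of Young inequalities, by choosing t. *)
Lemma sqr_le_young (p q r : R) : 0 <= p -> 0 <= q -> 0 <= r ->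
  (forall t, 0 < t -> 2 * p <= t * q + t^-1 * r) -> p ^+ 2 <= q * r.
Proof.
move=> p0 q0 r0 key; have [->|pn0] := eqVneq p 0.
  by rewrite expr0n/= mulr_ge0.
have pp : 0 < p by rewrite lt_neqAle eq_sym pn0.
have [qz|qn0] := eqVneq q 0.
  have := key ((r + 1) / p).
  rewrite divr_gt0 ?ltr_wpDl// qz mulr0 add0r => /(_ isT).
  rewrite invf_div mulrAC ler_pdivlMr ?ltr_wpDl// => h.
  by have pr := mulr_ge0 p0 r0; exfalso; lra.
have qp : 0 < q by rewrite lt_neqAle eq_sym qn0.
have := key (p / q); rewrite divr_gt0// => /(_ isT).
rewrite divfK// invf_div => h.
have : p <= q / p * r by lra.
by rewrite mulrAC ler_pdivlMr// expr2.
Qed.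

(** The bound |p + q|^2 <= (1 + B/A) |p|^2 + (1 + A/B) |q|^2, with A and B the
    two norms, sums to the square of A + B. *)
Lemma ell2_normD g u : ell2_norm (g + u) <= ell2_norm g + ell2_norm u.
Proof.
have a0 := ell2_norm_ge0 g; have b0 := ell2_norm_ge0 u.
set a := ell2_norm g in a0 *; set b := ell2_norm u in b0 *.
have [/ell2_norm_eq0 ->|an0] := eqVneq a 0; first by rewrite add0r lerDr.
have [/ell2_norm_eq0 ->|bn0] := eqVneq b 0; first by rewrite addr0 lerDl.
have ap : 0 < a by rewrite lt_neqAle eq_sym an0.
have bp : 0 < b by rewrite lt_neqAle eq_sym bn0.
apply: ell2_norm_le; first exact: addr_ge0.
have t0 : 0 <= 1 + b / a by rewrite addr_ge0// divr_ge0.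
have s0 : 0 <= 1 + a / b by rewrite addr_ge0// divr_ge0.
apply: (@le_trans _ _ (nsum (fun x => ((1 + b / a) * cmod (g x) ^+ 2
    + (1 + a / b) * cmod (u x) ^+ 2)%R))).
  apply: le_nsum => x; have := cmodD (g x) (u x).
  rewrite -[g x + u x]/((g + u) x) => h.
  apply: (@le_trans _ _ ((cmod (g x) + cmod (u x)) ^+ 2)).
    by rewrite ler_pXn2r// nnegrE ?addr_ge0 ?cmod_ge0.
  set p := cmod (g x); set q := cmod (u x).
  rewrite -subr_ge0 (_ : _ - _ = (b * p - a * q) ^+ 2 / (a * b)).
    by rewrite divr_ge0 ?sqr_ge0// mulr_ge0.
  by field; rewrite an0 bn0.
have sq (h : l2) x : 0 <= cmod (h x) ^+ 2 by exact: sqr_ge0.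
rewrite nsumD; [|by move=> x; rewrite mulr_ge0|by move=> x; rewrite mulr_ge0].
rewrite !nsumZ// -!ell2_norm_sqrE -!EFinM -EFinD lee_fin -/a -/b.
by rewrite le_eqVlt; apply/orP; left; apply/eqP; field; rewrite an0 bn0.
Qed.

Lemma ell2_normN g : ell2_norm (- g) = ell2_norm g.
Proof. by rewrite -scaleN1r ell2_normZ cmodN cmod1 mul1r. Qed.

Definition ell2_dot (g u : l2) : C := csum (fun x => g x * (u x)^*%C).

Lemma asummable_dot g u : asummable (fun x => g x * (u x)^*%C).
Proof.
apply: (@nsum_fin_le _ _ _ (fun x => cmod (g x) ^+ 2 + cmod (u x) ^+ 2)).
  move=> x; rewrite cmodM cmod_conj; have := cmod_ge0 (g x).
  have := cmod_ge0 (u x); move: (cmod _) (cmod _) => p q; nra.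
rewrite nsumD; [|by move=> x; exact: sqr_ge0|by move=> x; exact: sqr_ge0].
by rewrite -!ell2_norm_sqrE -EFinD ltry.
Qed.

Lemma ell2_dot_self g : ell2_dot g g = ((ell2_norm g ^+ 2)%:C)%C.
Proof.
rewrite ell2_norm_sqr; apply: complex_eq => /=.
  by apply: eq_rsum => x; rewrite Re_mul_conj.
rewrite (_ : (fun=> _) = (fun=> 0)); last first.
  by apply/funext => x; case: (g x) => a b /=; ring.
exact: (@rsum_supp1 _ _ _ 0).
Qed.

Lemma ell2_norm_subZ (c : R) g u :
  ell2_norm (g - (c%:C)%C *: u) ^+ 2 =
  ell2_norm g ^+ 2 - 2 * c * complex.Re (ell2_dot u g) + c ^+ 2 * ell2_norm u ^+ 2.
Proof.
have sq (h : l2) : nfin (fun x => `|cmod (h x) ^+ 2|).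
  have -> : (fun x => `|cmod (h x) ^+ 2|) = (fun x => cmod (h x) ^+ 2).
    by apply/funext => x; rewrite ger0_norm ?sqr_ge0.
  exact: ell2_fin.
have dt := asummable_Re (asummable_dot u g).
have fZ (r : R) (p : Zn -> R) : nfin (fun x => `|p x|) ->
    nfin (fun x => `|r * p x|).
  move=> pf; have -> : (fun x => `|r * p x|) = (fun x => `|r| * `|p x|).
    by apply/funext => x; rewrite normrM.
  by rewrite nsumZ// lte_mul_pinfty// lee_fin.
have fD (p q : Zn -> R) : nfin (fun x => `|p x|) -> nfin (fun x => `|q x|) ->
    nfin (fun x => `|p x + q x|).
  move=> pf qf; apply: (@nsum_fin_le _ _ _ (fun x => `|p x| + `|q x|)).
    by move=> x; exact: ler_normD.
  by rewrite nsumD// lte_add_pinfty.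
rewrite !ell2_norm_sqr -mulNr -(rsumZ _ dt) -(rsumD (sq g) (fZ _ _ dt)).
rewrite -(rsumZ _ (sq u)) -(rsumD (fD _ _ (sq g) (fZ _ _ dt)) (fZ _ _ (sq u))).
apply: eq_rsum => x.
rewrite -[(g - (c%:C)%C *: u) x]/(g x - (c%:C)%C * u x) -!Re_mul_conj.
case: (g x) (u x) => [p q] [r s] /=; ring.
Qed.

Section Operators.

Lemma bounded_op_le (T : l2 -> l2) : bounded_op T ->
  forall g, ell2_norm (T g) <= opnorm T * ell2_norm g.
Proof.
move=> [linT [M TM]] g.
have T0 : T 0 = 0.
  by have := linT (-1) 0 0; rewrite scaler0 addr0 scaleN1r addNr.
have [/ell2_norm_eq0 ->|gn0] := eqVneq (ell2_norm g) 0.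
  by rewrite T0 ell2_norm0 mulr0.
have gp : 0 < ell2_norm g by rewrite lt_neqAle eq_sym gn0 ell2_norm_ge0.
rewrite -ler_pdivrMr//.
pose c : C := ((ell2_norm g)^-1%:C)%C.
have cc : cmod c = (ell2_norm g)^-1.
  by rewrite cmod_real ger0_norm// invr_ge0 ell2_norm_ge0.
have -> : ell2_norm (T g) / ell2_norm g = ell2_norm (T (c *: g)).
  have := linT c g 0; rewrite T0 !addr0 => ->.
  by rewrite ell2_normZ cc mulrC.
apply: ub_le_sup; last first.
  by exists (c *: g) => //; rewrite /= ell2_normZ cc mulVf.
exists (`|M|) => _ [h /= h1 <-]; apply: (le_trans (TM h)).
apply: (@le_trans _ _ (`|M| * ell2_norm h)).
  by rewrite ler_wpM2r ?ell2_norm_ge0// ler_norm.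
by rewrite ler_piMr.
Qed.

Lemma opnorm_le (T : l2 -> l2) M : 0 <= M ->
  (forall g, ell2_norm (T g) <= M * ell2_norm g) -> opnorm T <= M.
Proof.
move=> M0 TM; apply: ge_sup.
  by exists (ell2_norm (T 0)); exists 0 => //=; rewrite ell2_norm0.
move=> _ [h /= h1 <-]; apply: (le_trans (TM h)).
by rewrite ler_piMr.
Qed.

Lemma opnorm_ge0 (T : l2 -> l2) : bounded_op T -> 0 <= opnorm T.
Proof.
move=> bT; rewrite leNgt; apply/negP => T0.
have h g : ell2_norm g = 0.
  apply/eqP; rewrite eq_le ell2_norm_ge0 andbT leNgt; apply/negP => g0.
  have := bounded_op_le bT g; rewrite leNgt => /negP; apply.
  by rewrite (lt_le_trans _ (ell2_norm_ge0 _))// nmulr_rlt0.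
move: T0; rewrite ltNge => /negP; apply.
apply: ub_le_sup; last by exists 0 => //=; rewrite h.
by exists 0 => _ [g _ <-]; rewrite h.
Qed.

Lemma bounded_op_lin (c : C) (S T : l2 -> l2) :
  bounded_op S -> bounded_op T -> bounded_op (c *: S + T).
Proof.
move=> bS bT; have hS := bounded_op_le bS; have hT := bounded_op_le bT.
have [lS _] := bS; have [lT _] := bT; split.
  move=> d g h; rewrite -[LHS]/(c *: S (d *: g + h) + T (d *: g + h)) lS lT.
  rewrite -[RHS]/(d *: (c *: S g + T g) + (c *: S h + T h)).
  rewrite !scalerDr !scalerA [c * d]mulrC -!addrA; congr (_ + _).
  by rewrite addrCA.
exists (cmod c * opnorm S + opnorm T) => g; rewrite mulrDl -mulrA.
apply: (le_trans (ell2_normD _ _)); apply: lerD => //.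
by rewrite ell2_normZ ler_wpM2l ?cmod_ge0.
Qed.

Lemma bounded_op_comp (S T : l2 -> l2) :
  bounded_op S -> bounded_op T -> bounded_op (S \o T).
Proof.
move=> bS bT; have hS := bounded_op_le bS; have hT := bounded_op_le bT.
have [lS _] := bS; have [lT _] := bT; split.
  by move=> d g h; rewrite /= lT lS.
exists (opnorm S * opnorm T) => g; apply: (le_trans (hS _)).
by rewrite -mulrA ler_wpM2l// opnorm_ge0.
Qed.

Lemma bounded_op_sub (S T : l2 -> l2) :
  bounded_op S -> bounded_op T -> bounded_op (S - T).
Proof.
by move=> bS bT; rewrite addrC -scaleN1r; exact: bounded_op_lin.
Qed.

Lemma opnorm_sub_le (S T : l2 -> l2) d g : bounded_op S -> bounded_op T ->
  opnorm (S - T) < d -> ell2_norm (S g - T g) <= d * ell2_norm g.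
Proof.
move=> bS bT dST.
apply: (le_trans (bounded_op_le (bounded_op_sub bS bT) g)).
by rewrite ler_wpM2r ?ell2_norm_ge0// ltW.
Qed.

End Operators.

Section Regular.
Variable theta : 'M[C]_n.
Hypothesis theta_circle : forall j k, cmod (theta j k) = 1.
Local Notation tw := (twconv theta).
Local Notation sg := (sigma theta).
Local Notation one1 := (fun _ : Zn => 1 : R).

Lemma lambda_val (f : Zn -> C) g : ell1 one1 f -> lambda theta f g = tw f g :> (Zn -> C).
Proof. exact: lambdaE. Qed.

(** Schur's test: Young's inequality bounds the square of the convolution at x
    by a multiple of the sum over y of |f(y)| |g(x-y)|^2, which Tonelli sums
    over x. *)
Lemma ell2_norm_lambda (f : Zn -> C) g : ell1 one1 f ->
  ell2_norm (lambda theta f g) <= ell1_norm one1 f * ell2_norm g.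
Proof.
move=> f1; pose S := ell1_norm one1 f.
have c0 (z : C) := cmod_ge0 z.
have SE : S%:E = nsum (fun y => cmod (f y)).
  rewrite (ell1_normK (w := one1)) //; apply: eq_nsum => y; exact: mulr1.
have S0 : 0 <= S by rewrite -lee_fin SE nsum_ge0.
apply: ell2_norm_le; first by rewrite mulr_ge0 ?ell2_norm_ge0.
pose B x : \bar R := nsum (fun y => cmod (f y) * cmod (g (x - y)) ^+ 2).
have B0 x : (0 <= B x)%E by apply: nsum_ge0 => y; rewrite mulr_ge0 ?sqr_ge0.
have BE : (\esum_(x in [set: Zn]) B x = S%:E * (ell2_norm g ^+ 2)%:E)%E.
  rewrite SE ell2_norm_sqrE -nsum_nsumM//; last 2 first.
  - by move=> x; exact: sqr_ge0.
  - exact: ell2_fin.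
  rewrite esum_swap; last by move=> x y; rewrite lee_fin mulr_ge0 ?sqr_ge0.
  apply: eq_esum => y _.
  by rewrite -[RHS](nsum_reindex (fun z => cmod (f y) * cmod (g z) ^+ 2) (subr_bij y)).
have pt x : ((cmod (tw f g x) ^+ 2)%:E <= S%:E * B x)%E.
  have Bfin : (B x < +oo)%E.
    have := @nsum_nsum_inner_fin R _ _ (fun x y => cmod (f y) * cmod (g (x - y)) ^+ 2).
    apply; first by move=> u y; rewrite mulr_ge0 ?sqr_ge0.
    by rewrite BE -EFinM ltry.
  have BxE : ((fine (B x))%:E = B x) by rewrite fineK// ge0_fin_numE.
  rewrite -BxE -EFinM lee_fin; set u := cmod _.
  have b0 : 0 <= fine (B x) by rewrite fine_ge0.
  have u0 : 0 <= u by exact: c0.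
  apply: sqr_le_young => // t t0; have ti : 0 < t^-1 by rewrite invr_gt0.
  rewrite -lee_fin EFinD (EFinM t) (EFinM t^-1) (EFinM 2) SE BxE.
  rewrite -nsumZ ?(ltW t0)// -nsumZ ?(ltW ti)//; last first.
    by move=> y; rewrite mulr_ge0 ?sqr_ge0.
  rewrite -nsumD; [|by move=> y; rewrite mulr_ge0// ltW|]; last first.
    by move=> y; rewrite mulr_ge0 ?(ltW ti)// mulr_ge0 ?sqr_ge0.
  apply: (@le_trans _ _ (2%:E * nsum (fun y => (cmod (f y) * cmod (g (x - y)))%R))%E).
    by rewrite lee_wpmul2l ?lee_fin// cmod_twconv_le.
  rewrite -nsumZ//; last by move=> y; rewrite mulr_ge0.
  apply: le_nsum => y; move: (c0 (f y)); move: (cmod (f y)) (cmod (g _)) => p q p0.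
  rewrite -subr_ge0 (_ : _ - _ = p / t * (t - q) ^+ 2); last first.
    by field; rewrite gt_eqF.
  by rewrite mulr_ge0 ?sqr_ge0// divr_ge0// ltW.
apply: (@le_trans _ _ (\esum_(x in [set: Zn]) (S%:E * B x))%E).
  by apply: le_esum => x _; rewrite lambda_val.
apply: (le_trans (esumZl_le S0 B0)); rewrite BE -!EFinM lee_fin.
by rewrite exprMn mulrA -expr2.
Qed.

Lemma lambda_bounded (f : Zn -> C) : ell1 one1 f -> bounded_op (lambda theta f).
Proof.
move=> f1; split; last by exists (ell1_norm one1 f) => g; exact: ell2_norm_lambda.
move=> c g u; apply: ell2_ext.
rewrite lambda_val// -[RHS]/(c *: (lambda theta f g : Zn -> C) + lambda theta f u).
by rewrite !lambda_val//; apply: twconv_linr => //; exact: ell2_cbounded.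
Qed.

Lemma ell1_1_lin (c : C) (f h : Zn -> C) :
  ell1 one1 f -> ell1 one1 h -> ell1 one1 (c *: f + h).
Proof. exact: ell1_lin. Qed.

Lemma lambda_lin (c : C) (f h : Zn -> C) : ell1 one1 f -> ell1 one1 h ->
  lambda theta (c *: f + h) = c *: lambda theta f + lambda theta h.
Proof.
move=> f1 h1; apply/funext => g; apply: ell2_ext.
rewrite lambda_val; last exact: ell1_1_lin.
rewrite -[RHS]/(c *: (lambda theta f g : Zn -> C) + lambda theta h g).
by rewrite !lambda_val//; apply: twconv_linl => //; exact: ell2_cbounded.
Qed.

Lemma ell1_1_algebra : is_algebra tw (@delta0 R n) (ell1 one1).
Proof. by apply: ell1_algebra => // x y; rewrite mulr1. Qed.

Lemma lambda_comp (f h : Zn -> C) : ell1 one1 f -> ell1 one1 h ->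
  lambda theta (tw f h) = lambda theta f \o lambda theta h.
Proof.
move=> f1 h1; apply/funext => g; apply: ell2_ext.
rewrite lambda_val; last exact: (alg_mul ell1_1_algebra).
rewrite /= !lambda_val// twconvA//; exact: ell2_cbounded.
Qed.

Lemma lambda_one : lambda theta (@delta0 R n) = idfun.
Proof.
apply/funext => g; apply: ell2_ext.
by rewrite lambda_val ?twconv1l//; exact: (alg_one ell1_1_algebra).
Qed.

Lemma lambda_nctorus (f : Zn -> C) : ell1 one1 f -> nctorus theta (lambda theta f).
Proof.
move=> f1; split; first exact: lambda_bounded.
move=> e e0; exists f => //; rewrite subrr.
apply: le_lt_trans e0; apply: opnorm_le => // g.
by rewrite mul0r -[X in ell2_norm X]/(0 : l2) ell2_norm0.
Qed.

Lemma nctorus_lin (c : C) (S T : l2 -> l2) :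
  nctorus theta S -> nctorus theta T -> nctorus theta (c *: S + T).
Proof.
move=> [bS aS] [bT aT]; split; first exact: bounded_op_lin.
move=> e e0; have c1 : 0 < cmod c + 1 by rewrite ltr_wpDl// cmod_ge0.
have d0 : 0 < e / (cmod c + 1) / 2 by rewrite !divr_gt0.
have [f f1 hf] := aS _ d0; have [h h1 hh] := aT _ d0.
exists (c *: f + h); first exact: ell1_1_lin.
set d := e / _ / 2 in d0 hf hh.
have E : e = (cmod c + 1) * d * 2 by rewrite /d; field; rewrite gt_eqF.
apply: (@le_lt_trans _ _ ((cmod c + 1) * d)); last first.
  by have dp := mulr_gt0 c1 d0; rewrite E ltr_pMr // ltr1n.
apply: opnorm_le => [|g]; first by rewrite mulr_ge0 ?ltW.
rewrite lambda_lin//.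
have hS := opnorm_sub_le g bS (lambda_bounded f1) hf.
have hT := opnorm_sub_le g bT (lambda_bounded h1) hh.
rewrite -[X in ell2_norm X]/(c *: S g + T g
  - (c *: lambda theta f g + lambda theta h g)).
rewrite opprD addrACA -scalerBr.
apply: (le_trans (ell2_normD _ _)); rewrite ell2_normZ mulrDl mul1r mulrDl.
apply: lerD; last exact: hT.
rewrite -mulrA; exact: ler_wpM2l (cmod_ge0 c) _ _ hS.
Qed.

Lemma nctorus_comp (S T : l2 -> l2) :
  nctorus theta S -> nctorus theta T -> nctorus theta (S \o T).
Proof.
move=> [bS aS] [bT aT]; split; first exact: bounded_op_comp.
move=> e e0; have S0 := opnorm_ge0 bS; have T0 := opnorm_ge0 bT.
have c1 : 0 < opnorm S + opnorm T + 2 by rewrite ltr_wpDl// addr_ge0.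
(* d <= 1 bounds the quadratic term of the error by a linear one *)
pose d := Num.min 1 (e / (opnorm S + opnorm T + 2)).
have d0 : 0 < d by rewrite lt_min ltr01 divr_gt0.
have d1 : d <= 1 by rewrite ge_min lexx.
have de : d * (opnorm S + opnorm T + 2) <= e.
  by rewrite -ler_pdivlMr// ge_min lexx orbT.
have [f f1 hf] := aS _ d0; have [h h1 hh] := aT _ d0.
exists (tw f h); first exact: (alg_mul ell1_1_algebra).
apply: (@le_lt_trans _ _ (opnorm S * d + d * (opnorm T + d))); last first.
  apply: lt_le_trans de; rewrite -subr_gt0.
  rewrite (_ : _ - _ = d * (1 - d) + d); last by ring.
  by rewrite ltr_wpDl// mulr_ge0 ?subr_ge0// ltW.
apply: opnorm_le => [|g].
  by rewrite addr_ge0// mulr_ge0// ?addr_ge0// ltW.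
rewrite lambda_comp//; have g0 := ell2_norm_ge0 g.
have hT := opnorm_sub_le g bT (lambda_bounded h1) hh.
have hS := opnorm_sub_le (lambda theta h g) bS (lambda_bounded f1) hf.
have hl : ell2_norm (lambda theta h g) <= (opnorm T + d) * ell2_norm g.
  rewrite -[X in ell2_norm X](subKr (T g)).
  apply: (le_trans (ell2_normD _ _)); rewrite ell2_normN mulrDl.
  exact: lerD (bounded_op_le bT g) hT.
rewrite -[X in ell2_norm X]/(S (T g) - lambda theta f (lambda theta h g)).
have -> : S (T g) = S (T g - lambda theta h g) + S (lambda theta h g).
  have [lS _] := bS.
  by have := lS 1 (T g - lambda theta h g) (lambda theta h g);
    rewrite !scale1r subrK.
rewrite -addrA; apply: (le_trans (ell2_normD _ _)); rewrite mulrDl.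
apply: lerD.
  apply: (le_trans (bounded_op_le bS _)); rewrite -mulrA.
  exact: ler_wpM2l S0 _ _ hT.
apply: (le_trans hS); rewrite -mulrA; exact: ler_wpM2l (ltW d0) _ _ hl.
Qed.

Lemma nctorus_algebra :
  is_algebra (fun S T : l2 -> l2 => S \o T) idfun (nctorus theta).
Proof.
split.
- by rewrite -lambda_one; apply: lambda_nctorus; exact: (alg_one ell1_1_algebra).
- exact: nctorus_lin.
- exact: nctorus_comp.
- by [].
- by [].
- by [].
- by [].
- move=> c S T U _ _ [[lU _] _]; apply/funext => g.
  exact: (lU c (S g) (T g)).
Qed.

(** The involution of the twisted convolution algebra. *)
Definition twstar (f : Zn -> C) : Zn -> C :=
  fun x => (sg x (- x))^*%C * (f (- x))^*%C.

Lemma ell1_twstar (w : Zn -> R) f : (forall x, w (- x) = w x) ->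
  ell1 w f -> ell1 w (twstar f).
Proof.
move=> wN; rewrite /ell1/= => ff; apply: le_lt_trans ff.
have bN : bijective (@GRing.opp Zn) by exists -%R; exact: opprK.
rewrite -[leRHS](nsum_reindex (fun x => cmod (f x) * w x) bN).
by apply: le_nsum => x; rewrite cmodM !cmod_conj cmod_sigma// mul1r wN.
Qed.

(** The product P Q is at most P^2 + Q^2, and each square is summable. *)
Lemma adjoint_summable (p P Q : Zn -> R) :
  (forall x, 0 <= p x) -> (forall x, 0 <= P x) -> (forall x, 0 <= Q x) ->
  nfin p -> nfin (fun x => P x ^+ 2) -> nfin (fun x => Q x ^+ 2) ->
  (\esum_(y in [set: Zn]) nsum (fun x => (p y * (P x * Q (x - y)))%R) < +oo)%E.
Proof.
move=> p0 P0 Q0 pf Pf Qf.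
have P20 x : 0 <= P x ^+ 2 by exact: sqr_ge0.
have Q20 x : 0 <= Q x ^+ 2 by exact: sqr_ge0.
pose M := fine (nsum (fun x => P x ^+ 2)) + fine (nsum (fun x => Q x ^+ 2)).
have M0 : 0 <= M by rewrite addr_ge0 ?fine_nsum_ge0.
apply: (@le_lt_trans _ _ (nsum (fun y => (M * p y)%R))); last first.
  by rewrite nsumZ// lte_mul_pinfty.
apply: le_esum => y _.
apply: (@le_trans _ _ (nsum (fun x => (p y * (P x ^+ 2 + Q (x - y) ^+ 2))%R))).
  apply: le_nsum => x; rewrite ler_wpM2l//.
  by have := P0 x; have := Q0 (x - y); move: (P x) (Q _) => r s; nra.
rewrite nsumZ//; last by move=> x; exact: addr_ge0.
rewrite nsumD// mulrC EFinM lee_wpmul2l ?lee_fin//.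
rewrite (nsum_reindex (fun z => Q z ^+ 2) (subr_bij y)).
by rewrite /M EFinD !fine_nsumK.
Qed.

Lemma sigmaNl_conj x y : sg (- x) y = (sg x y)^*%C.
Proof.
apply: (mulfI (sigma_neq0 theta_circle x y)).
by rewrite mulrC sigmaNl// cmod1_conj ?cmod_sigma.
Qed.

(** Fubini and the substitutions y -> -y, x -> x - y; the phase in twstar is the
    one for which the cocycles cancel. *)
Lemma lambda_adjoint (f : Zn -> C) g u : ell1 one1 f ->
  ell2_dot (lambda theta (twstar f) u) g = ell2_dot u (lambda theta f g).
Proof.
move=> f1; have s1 : ell1 one1 (twstar f) by exact: ell1_twstar.
have fs := ell1_asummable f1; have ss := ell1_asummable s1.
rewrite /ell2_dot lambda_val// lambda_val//.
pose H x y := (f y)^*%C * (u x * (g (x - y))^*%C) * (sg y (x - y))^*%C.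
have cH x y : cmod (H x y) = cmod (f y) * (cmod (u x) * cmod (g (x - y))).
  by rewrite !cmodM !cmod_conj cmod_sigma// mulr1.
pose K x y := twstar f y * (u (x - y) * (g x)^*%C) * sg y (x - y).
have cK x y : cmod (K x y) = cmod (twstar f y) * (cmod (g x) * cmod (u (x - y))).
  rewrite cmodM cmod_sigma// mulr1 (cmodM (twstar f y)).
  by rewrite (cmodM (u (x - y))) cmod_conj [cmod (g x) * _]mulrC.
have sH : (\esum_(y in [set: Zn]) nsum (fun x => cmod (H x y)) < +oo)%E.
  rewrite (eq_esum (b := fun y => nsum (fun x =>
    (cmod (f y) * (cmod (u x) * cmod (g (x - y))))%R))); last first.
    by move=> y _; apply: eq_nsum => x.
  by apply: (@adjoint_summable (fun x => cmod (f x)) (fun x => cmod (u x))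
    (fun x => cmod (g x))) => //; first [exact: ell2_fin|move=> x; exact: cmod_ge0].
have sK : (\esum_(y in [set: Zn]) nsum (fun x => cmod (K x y)) < +oo)%E.
  rewrite (eq_esum (b := fun y => nsum (fun x =>
    (cmod (twstar f y) * (cmod (g x) * cmod (u (x - y))))%R))); last first.
    by move=> y _; apply: eq_nsum => x.
  by apply: (@adjoint_summable (fun x => cmod (twstar f x)) (fun x => cmod (g x))
    (fun x => cmod (u x))) => //; first [exact: ell2_fin|move=> x; exact: cmod_ge0].
transitivity (csum (fun x => csum (fun y => K x y))).
  apply: eq_csum => x; rewrite mulrC -csumZ; last first.
    by apply: asummable_twterm => //; exact: ell2_cbounded.
  by apply: eq_csum => y; rewrite /K; ring.
rewrite -(csum_fubini (F := fun y x => K x y))//.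
have bN : bijective (@GRing.opp Zn) by exists -%R; exact: opprK.
rewrite -(csum_reindex (fun y => csum (fun x => K x y)) bN).
transitivity (csum (fun y => csum (fun x => H x y))).
  apply: eq_csum => y; rewrite -(csum_reindex (fun x => K x (- y)) (subr_bij y)).
  apply: eq_csum => x; rewrite /K /H /twstar !opprK subrK.
  have -> : sg (- y) x = (sg (- y) y) * (sg y (x - y))^*%C.
    by rewrite -sigmaNl_conj -sigmaDr// addrC subrK.
  rewrite (_ : _ * _ = (f y)^*%C * (u x * (g (x - y))^*%C) * (sg y (x - y))^*%C
    * (sg (- y) y * (sg (- y) y)^*%C)); last by ring.
  by rewrite cmod1_conj ?cmod_sigma// mulr1.
rewrite (csum_fubini (F := fun y x => H x y))//.
apply: eq_csum => x.
have ts := asummable_twterm theta_circle x f1 (ell2_cbounded g).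
rewrite -(csum_conj ts) -csumZ; last first.
  by apply: nsum_fin_le ts => y; rewrite cmod_conj.
by apply: eq_csum => y; rewrite /H !rmorphM /=; ring.
Qed.

End Regular.
End Ell2Theory.

(** * Inverse-closedness of l^1 with a subexponential weight *)

Section InverseClosed.
Variables (R : realType) (n : nat) (theta : 'M[R[i]]_n).
Variables (N : 'rV[R]_n -> R) (a b : R).
Hypothesis theta_circle : forall j k, cmod (theta j k) = 1.
Hypothesis N_norm : is_norm N.
Hypotheses (a_gt0 : 0 < a) (b_gt0 : 0 < b) (b_lt1 : b < 1).
Local Notation C := R[i].
Local Notation Zn := 'rV[int]_n.
Local Notation l2 := (ell2 R n).
Local Notation tw := (twconv theta).
Local Notation one := (@delta0 R n).
Local Notation lam := (lambda theta).
Local Notation v := (subexp_weight N a b).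
Local Notation vb := (subexp_weight_pow N a b).
Local Notation pw h k := (iter k (tw h) one).

Let v_ge1 := subexp_weight_ge1 N b a_gt0.
Let vM := subexp_weightM N_norm a_gt0 b_gt0 b_lt1.

Let v_ge0 (x : Zn) : 0 <= v x. Proof. exact: expR_ge0. Qed.

Lemma subexp_banach : is_banach_algebra tw one (ell1_norm v) (ell1 v).
Proof. by apply: ell1_banach => //; exact: subexp_weight0. Qed.

Lemma subexp_sub1 f : ell1 v f -> ell1 (fun=> 1) f.
Proof. exact: ell1_sub1. Qed.

(** Pointwise v^b <= v / t + t^q / v; the part with 1 / v is bounded by Young's
    inequality with parameter s and by the square summability of 1 / v. *)
Lemma subexp_interpolation : exists D : R, exists q : nat, 0 <= D /\
  forall (f : Zn -> C) s t, ell1 v f -> 0 < s -> 1 <= t ->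
    (nsum (fun x => (cmod (f x) ^+ 2)%R) <= (s ^+ 2)%:E)%E ->
    (ell1_enorm vb f <= (ell1_norm v f / t + D * t ^+ q * s)%:E)%E.
Proof.
have [q hq] := subexp_weight_pow_le N a_gt0 b_gt0 b_lt1.
have Kf := nfin_subexp_weight N_norm a_gt0 b_gt0 b_lt1.
have c0 (z : C) := cmod_ge0 z.
have v0 x : 0 < v x by rewrite expR_gt0.
have k0 x : 0 <= (v x) ^- 2 by rewrite invr_ge0 exprn_ge0// ltW.
pose K := fine (nsum (fun x => (v x) ^- 2)).
have K0 : 0 <= K by rewrite fine_nsum_ge0.
exists (1 + K), q; split; first exact: addr_ge0.
move=> f s t fv s0 t1 fs; have t0 : 0 < t := lt_le_trans ltr01 t1.
have m0 x : 0 <= t^-1 * (cmod (f x) * v x) by rewrite !mulr_ge0// invr_ge0 ltW.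
have tq0 : 0 <= t ^+ q by rewrite exprn_ge0// ltW.
have sq0 x : 0 <= cmod (f x) ^+ 2 by exact: sqr_ge0.
have si : 0 <= s^-1 by rewrite invr_ge0 ltW.
have p0 x : 0 <= s^-1 * cmod (f x) ^+ 2 by rewrite mulr_ge0.
have r0 x : 0 <= s * (v x) ^- 2 by rewrite mulr_ge0// ltW.
apply: (@le_trans _ _ (nsum (fun x => (t^-1 * (cmod (f x) * v x)
  + t ^+ q * (s^-1 * cmod (f x) ^+ 2 + s * (v x) ^- 2))%R))).
  apply: le_nsum => x.
  apply: (@le_trans _ _ (cmod (f x) * (v x / t + t ^+ q * (v x)^-1))).
    by rewrite ler_wpM2l// hq.
  rewrite [leLHS](_ : _ = t^-1 * (cmod (f x) * v x) + t ^+ q * (cmod (f x) * (v x)^-1)).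
    rewrite lerD2l ler_wpM2l// -exprVn.
    have vi : 0 <= (v x)^-1 by rewrite invr_ge0 ltW.
    have pv := mulr_ge0 (c0 (f x)) vi.
    rewrite -subr_ge0.
    rewrite (_ : _ - _ = s^-1 * (cmod (f x) - s * (v x)^-1) ^+ 2
      + cmod (f x) * (v x)^-1).
      by rewrite addr_ge0// mulr_ge0// sqr_ge0.
    by field; rewrite !gt_eqF.
  by ring.
have q0 x : 0 <= cmod (f x) * v x by rewrite mulr_ge0.
have pr0 x : 0 <= s^-1 * cmod (f x) ^+ 2 + s * (v x) ^- 2 by rewrite addr_ge0.
have tpr0 x : 0 <= t ^+ q * (s^-1 * cmod (f x) ^+ 2 + s * (v x) ^- 2).
  by rewrite mulr_ge0.
have ti : 0 <= t^-1 by rewrite invr_ge0 ltW.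
rewrite (nsumD m0 tpr0) (nsumZ ti q0) (nsumZ tq0 pr0) (nsumD p0 r0).
rewrite (nsumZ si sq0) (nsumZ (ltW s0) k0) -(fine_nsumK k0 Kf) -/K.
rewrite -[nsum (fun x => cmod (f x) * v x)](ell1_normK v_ge1 fv).
have -> : ell1_norm v f / t + (1 + K) * t ^+ q * s =
  t^-1 * ell1_norm v f + t ^+ q * (s^-1 * s ^+ 2 + s * K).
  by field; rewrite !gt_eqF.
rewrite [leRHS]EFinD leeD ?EFinM// lee_wpmul2l ?lee_fin//.
by rewrite EFinD leeD ?EFinM// lee_wpmul2l ?lee_fin.
Qed.

Lemma delta0_ell2 : one \in @ell2_pred R n.
Proof.
rewrite unfold_in /ell2_esqnorm -[X in (X < _)%E]/(nsum _).
rewrite (@nsum_fin_supp1 _ _ _ 0) ?ltry ?sqr_ge0// => x x0.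
by rewrite /delta0 (negbTE x0) cmod0 expr0n.
Qed.

(** The powers of h in the convolution algebra are the iterates of lambda(h) on
    the unit vector delta_0. *)
Lemma ell2_norm_pow (h : Zn -> C) rho k : ell1 (fun=> 1) h -> 0 <= rho ->
  (forall u, ell2_norm (lam h u) <= rho * ell2_norm u) ->
  (nsum (fun x => (cmod (pw h k x) ^+ 2)%R) <= ((rho ^+ k) ^+ 2)%:E)%E.
Proof.
move=> h1 rho0 hrho; pose d : l2 := Ell2 delta0_ell2.
have dn : ell2_norm d = 1.
  apply: (pexpIrn (n := 2)); rewrite ?nnegrE ?ell2_norm_ge0//.
  rewrite expr1n; apply/EFin_inj; rewrite ell2_norm_sqrE.
  rewrite (@nsum_fin_supp1 _ _ _ 0) ?sqr_ge0//=.
    by rewrite /delta0 eqxx cmod1 expr1n.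
  by move=> x x0; rewrite /delta0 (negbTE x0) cmod0 expr0n.
have E : pw h k = iter k (lam h) d :> (Zn -> C).
  elim: k => [//|k ih]; rewrite !iterS lambda_val//; congr (tw h _); exact: ih.
rewrite E -ell2_norm_sqrE lee_fin ler_pXn2r ?nnegrE ?exprn_ge0 ?ell2_norm_ge0//.
elim: k {E} => [|k ih]; first by rewrite dn.
rewrite iterS exprS; apply: (le_trans (hrho _)).
exact: ler_wpM2l rho0 _ _ ih.
Qed.

(** Interpolation turns the bound rho^k for the l^2 norms of the powers of h
    into the recursive inequality of [brandenburg_small] for the l^1_v norms
    of the powers h^(2^k). *)
Lemma subexp_left_inverse (h : Zn -> C) rho : ell1 v h -> 0 < rho < 1 ->
  (forall u, ell2_norm (lam h u) <= rho * ell2_norm u) ->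
  exists2 s, ell1 v s & tw s (one - h) = one.
Proof.
move=> hv rho01 hrho; have /andP[rho0 rho1] := rho01.
have BA := subexp_banach; have h1 := subexp_sub1 hv.
have Pv k : ell1 v (pw h k) := alg_pow BA k hv.
have [D [q [D0 interp]]] := subexp_interpolation.
pose F k := ell1_norm v (pw h (2 ^ k)).
have vb0 x : 0 <= vb x := subexp_weight_pow_ge0 N a b x.
have F0 k : 0 <= F k by exact: ell1_norm_ge0.
have Fstep k t : 1 <= t ->
    F k.+1 <= 2 * F k * (F k / t + D * t ^+ q * rho ^+ (2 ^ k)).
  move=> t1; set X := _ + _.
  have fX : (ell1_enorm vb (pw h (2 ^ k)) <= X%:E)%E.
    apply: interp => //; first exact: exprn_gt0.
    exact: ell2_norm_pow h1 (ltW rho0) hrho.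
  rewrite /F expnS mul2n -addnn -(alg_powD BA)//.
  have fb : ell1 vb (pw h (2 ^ k)) by apply: (le_lt_trans fX); rewrite ltry.
  apply: (ell1_norm_le v_ge1 _).2.
  apply: (le_trans (ell1_twconvM2 theta_circle _ _ _ _ _ _
    (subexp_weightD N_norm a_gt0 b_gt0 b_lt1) fb (Pv _))) => //.
  rewrite -(ell1_normK v_ge1 (Pv _)) -/(F k).
  rewrite (_ : 2 * F k * X = F k * X + X * F k); last by ring.
  rewrite EFinD !EFinM leeD//.
    by rewrite lee_wpmul2l ?lee_fin.
  by rewrite lee_wpmul2r ?lee_fin.
have [k Fk] := brandenburg_small rho01 D0 Fstep.
by apply: (neumann_left_inverse (m := (2 ^ k)%N) BA hv); exact: Fk.
Qed.

Lemma lambdaZ (c : C) (f : Zn -> C) g : ell1 (fun=> 1) f ->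
  lam (c *: f) g = c *: lam f g.
Proof.
move=> f1; have z : lam 0 = 0.
  have := lambda_lin theta_circle (-1) f1 f1.
  by rewrite scaleN1r addNr scaleN1r addNr.
have f0 : ell1 (fun=> 1) (0 : Zn -> C) by rewrite /ell1/= ell1_enorm0.
by have := lambda_lin theta_circle c f1 f0; rewrite z !addr0 => ->.
Qed.

Lemma sqr_le_mul (p q r : R) : 0 <= p -> 0 <= q -> 0 <= r -> p <= q * r ->
  p ^+ 2 <= q ^+ 2 * r ^+ 2.
Proof. by move=> *; rewrite -exprMn lerXn2r// nnegrE mulr_ge0. Qed.

(** The square of the norm of (1 - A^* A / M^2) g is expanded, with G, A and B the
    squared norms of g, A g and A^* A g. *)
Lemma contraction_estimate (M m G A B : R) : 0 < M -> 0 < m -> 0 <= G ->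
  G <= m ^+ 2 * A -> B <= M ^+ 2 * A ->
  G - 2 * M ^- 2 * A + (M ^- 2) ^+ 2 * B <= (1 - (M * m) ^- 2 / 2) ^+ 2 * G.
Proof.
move=> M0 m0 G0 hA hB; set c := M ^- 2; set e := (M * m) ^- 2.
have c0 : 0 < c by rewrite invr_gt0 exprn_gt0.
have e0 : 0 < e by rewrite invr_gt0 exprn_gt0// mulr_gt0.
have hcB : c ^+ 2 * B <= c * A.
  apply: (@le_trans _ _ (c ^+ 2 * (M ^+ 2 * A))).
    by rewrite ler_wpM2l// exprn_ge0// ltW.
  rewrite le_eqVlt; apply/orP; left; apply/eqP; rewrite /c; field.
  by rewrite gt_eqF.
have heG : e * G <= c * A.
  apply: (@le_trans _ _ (e * (m ^+ 2 * A))); first by rewrite ler_wpM2l// ltW.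
  rewrite le_eqVlt; apply/orP; left; apply/eqP; rewrite /c /e; field.
  by rewrite !gt_eqF.
have e2G : 0 <= (e / 2) ^+ 2 * G by rewrite mulr_ge0// sqr_ge0.
rewrite (_ : (1 - e / 2) ^+ 2 * G = G - e * G + (e / 2) ^+ 2 * G); last by field.
lra.
Qed.

(** With M a bound for A^*, expanding the square gives
    ||g - A^* A g / M^2||^2 <= ||g||^2 - ||A g||^2 / M^2, and ||A g|| is at least
    ||g|| / m. *)
Lemma lambda_contraction (f : Zn -> C) m : ell1 (fun=> 1) f -> 1 <= m ->
  (forall g, ell2_norm g <= m * ell2_norm (lam f g)) ->
  exists c rho : R, 0 < rho < 1 /\ forall g,
    ell2_norm (g - lam ((c%:C)%C *: twstar theta f) (lam f g)) <= rho * ell2_norm g.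
Proof.
move=> f1 m1 hm; have s1 : ell1 (fun=> 1) (twstar theta f) by exact: ell1_twstar.
pose M := ell1_norm (fun=> 1) (twstar theta f) + 1.
have M1 : 1 <= M by rewrite lerDr ell1_norm_ge0.
have M0 : 0 < M := lt_le_trans ltr01 M1.
have m0 : 0 < m := lt_le_trans ltr01 m1.
have Mm1 : 1 <= M * m by rewrite mulr_ege1.
have Mm0 : 0 < M * m := lt_le_trans ltr01 Mm1.
have rho01 : 0 < 1 - (M * m) ^- 2 / 2 < 1.
  have e0 : 0 < (M * m) ^- 2 by rewrite invr_gt0 exprn_gt0.
  have e1 : (M * m) ^- 2 <= 1 by rewrite invf_le1 ?exprn_gt0// exprn_ege1.
  by move: ((M * m) ^- 2) e0 e1 => e e0 e1; apply/andP; split; lra.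
(* for e = (M m)^-2 <= 1 the number 1 - e/2 is positive and its square is at
   least 1 - e *)
exists (M ^- 2), (1 - (M * m) ^- 2 / 2); split => // g.
have /andP[/ltW r0 _] := rho01.
have hB : ell2_norm (lam (twstar theta f) (lam f g)) ^+ 2 <=
    M ^+ 2 * ell2_norm (lam f g) ^+ 2.
  apply: (sqr_le_mul (ell2_norm_ge0 _) (ltW M0) (ell2_norm_ge0 _)).
  apply: (le_trans (ell2_norm_lambda theta_circle (lam f g) s1)).
  by apply: ler_wpM2r; [exact: ell2_norm_ge0|rewrite lerDl].
have hA : ell2_norm g ^+ 2 <= m ^+ 2 * ell2_norm (lam f g) ^+ 2.
  exact: sqr_le_mul (ell2_norm_ge0 _) (ltW m0) (ell2_norm_ge0 _) (hm g).
have pos : 0 <= (1 - (M * m) ^- 2 / 2) * ell2_norm g.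
  by apply: mulr_ge0 => //; exact: ell2_norm_ge0.
rewrite -(@ler_pXn2r _ 2) ?nnegrE ?ell2_norm_ge0 ?pos//.
rewrite (lambdaZ _ _ s1) ell2_norm_subZ (lambda_adjoint theta_circle _ _ f1).
rewrite ell2_dot_self exprMn [complex.Re _]/=.
exact: contraction_estimate M0 m0 (sqr_ge0 _) hA hB.
Qed.

Lemma subexp_inverse_closed :
  inverse_closed (fun S T : l2 -> l2 => S \o T) idfun
    (lam @` ell1 v) (nctorus theta).
Proof.
have BA := subexp_banach; have AA := ban_alg BA.
have NA := nctorus_algebra theta_circle.
have sub : lam @` ell1 v `<=` nctorus theta.
  by move=> _ [f fv <-]; apply: lambda_nctorus => //; exact: subexp_sub1.
split.
  split => //; split.
  - by exists one; [exact: (alg_one AA)|exact: lambda_one].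
  - move=> c _ _ [f fv <-] [g gv <-]; exists (c *: f + g).
      exact: (alg_lin AA).
    by rewrite lambda_lin//; exact: subexp_sub1.
  - move=> _ _ [f fv <-] [g gv <-]; exists (tw f g).
      exact: (alg_mul AA).
    by rewrite lambda_comp//; exact: subexp_sub1.
  - by [].
  - by [].
  - by [].
  - by [].
  - move=> c S T U /sub hS /sub hT /sub hU; exact: (alg_linr NA).
move=> _ T [f fv <-] [bT _] fT Tf.
have f1 := subexp_sub1 fv.
have m1 : 1 <= opnorm T + 1 by rewrite lerDr opnorm_ge0.
have hm g : ell2_norm g <= (opnorm T + 1) * ell2_norm (lam f g).
  have -> : ell2_norm g = ell2_norm (T (lam f g)).
    by rewrite -[T (lam f g)]/((T \o lam f) g) Tf.
  apply: (le_trans (bounded_op_le bT _)).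
  by apply: ler_wpM2r; [exact: ell2_norm_ge0|rewrite lerDl].
have [c [rho [rho01 hrho]]] := lambda_contraction f1 m1 hm.
pose p := (c%:C)%C *: twstar theta f.
have pv : ell1 v p.
  have := alg_lin AA (c%:C)%C (ell1_twstar theta_circle
    (subexp_weightN N_norm a b) fv) (alg_0 BA).
  by rewrite addr0.
have p1 := subexp_sub1 pv.
have pfv : ell1 v (tw p f) := alg_mul AA pv fv.
pose h := one - tw p f; have hv : ell1 v h := alg_sub BA (alg_one AA) pfv.
have lh g : lam h g = g - lam p (lam f g).
  have -> : h = -1 *: tw p f + one by rewrite /h addrC scaleN1r.
  rewrite lambda_lin ?lambda_one//; first last.
  - exact: subexp_sub1 (alg_one AA).
  - exact: subexp_sub1.
  rewrite lambda_comp// -[LHS]/(-1 *: lam p (lam f g) + g).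
  by rewrite scaleN1r addrC.
have [s sv sh] : exists2 s, ell1 v s & tw s (one - h) = one.
  by apply: (subexp_left_inverse hv rho01) => g; rewrite lh.
pose g0 := tw s p; have gv : ell1 v g0 := alg_mul AA sv pv.
have gf : tw g0 f = one by rewrite /g0 -(alg_mulA AA)// -[RHS]sh /h subKr.
exists g0 => //; have g1 := subexp_sub1 gv.
rewrite -[LHS]/(lam g0 \o idfun) -fT -[LHS]/((lam g0 \o lam f) \o T).
by rewrite -lambda_comp// gf lambda_one.
Qed.

Lemma smooth_torus_algebra : is_algebra tw one (smooth_torus N).
Proof.
have PA s : 0 <= s -> is_algebra tw one (ell1 (poly_weight N s)).
  move=> s0; apply: ell1_algebra => // [x|x y].
    exact: poly_weight_ge1.
  exact: poly_weightM.
have P0 := PA 0 (lexx 0).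
have S0 f : smooth_torus N f -> ell1 (poly_weight N 0) f.
  by move=> hf; exact: hf 0 (lexx 0).
split.
- by move=> s s0; exact: (alg_one (PA s s0)).
- by move=> c f g hf hg s s0; apply: (alg_lin (PA s s0)); [exact: hf|exact: hg].
- by move=> f g hf hg s s0; apply: (alg_mul (PA s s0)); [exact: hf|exact: hg].
- by move=> f g h /S0 ? /S0 ? /S0 ?; exact: (alg_mulA P0).
- by move=> f /S0 ?; exact: (alg_mul1l P0).
- by move=> f /S0 ?; exact: (alg_mul1r P0).
- by move=> c f g h /S0 ? /S0 ? /S0 ?; exact: (alg_linl P0).
- by move=> c f g h /S0 ? /S0 ? /S0 ?; exact: (alg_linr P0).
Qed.

Lemma subexp_sub_smooth : ell1 v `<=` smooth_torus N.
Proof.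
move=> f fv s /= s0; have [D D0 hD] := powR1D_le_exp a_gt0 b_gt0 b_lt1 s0.
apply: (ell1_le _ D0 v_ge0 fv) => x.
exact: hD _ (latnorm_ge0 N_norm x).
Qed.

End InverseClosed.

Theorem mainTheorem3 (R : realType) (n : nat) (theta : 'M[R[i]]_n)
    (N : 'rV[R]_n -> R) (a b : R)
    (n_ge1 : (1 <= n)%N)
    (theta_circle : forall j k, cmod (theta j k) = 1)
    (theta_conj : forall j k, theta k j = ((theta j k)^*)%C)
    (theta_diag : forall j, theta j j = 1)
    (N_norm : is_norm N)
    (a_gt0 : 0 < a) (b_gt0 : 0 < b) (b_lt1 : b < 1) :
  let v := subexp_weight N a b in
  [/\ inverse_closed (fun S T : ell2 R n -> ell2 R n => S \o T) idfun
        (lambda theta @` ell1 v) (nctorus theta),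
      is_banach_algebra (twconv theta) (@delta0 R n) (ell1_norm v) (ell1 v) &
      is_subalgebra (twconv theta) (@delta0 R n) (ell1 v) (smooth_torus N)].
Proof.
move=> v; have BA := subexp_banach theta_circle N_norm a_gt0 b_gt0 b_lt1.
split; [exact: subexp_inverse_closed|exact: BA|].
split; [exact: ban_alg BA|exact: smooth_torus_algebra|exact: subexp_sub_smooth].
Qed.
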